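(* Let $n\geq 2$. The collection of all deformation cones of $2$-nestohedra in $\mathbb R^n$, together with their faces, forms a fan.
   Context: Conventions. Polytopes live in $\mathbb R^n$, with lattice $\mathbb Z^n$ and the dot product. $h(\mathsf P,u)=\min_{x\in\mathsf P}u\cdot x$. The normal fan $\Sigma(\mathsf P)$ is the collection of the normal cones $\{u : u\cdot x=h(\mathsf P,u)\ \forall x\in\mathsf F\}$ of nonempty faces $\mathsf F$ of $\mathsf P$; its lineality space is $\mathsf L=\{w : w\cdot x\text{ constant on }\mathsf P\}$. Let $\mathsf S$ be a simple polytope. For a facet $\mathsf G$, $u_{\mathsf G}\in\mathbb Z^n$ is a fixed inner normal whose image in $\mathbb Z^n/(\mathbb Z^n\cap\mathsf L)$ is primitive; for a nonempty proper face $\mathsf F$, $u_{\mathsf F}=\sum_{\mathsf G\supseteq\mathsf F}u_{\mathsf G}$ over facets containing $\mathsf F$. $\operatorname{Tr}_\epsilon[\mathsf S,\mathsf F]=\{x\in\mathsf S : u_{\mathsf F}\cdot x\ge h(\mathsf S,u_{\mathsf F})+\epsilon\}$; this is shallow if $0<\epsilon<\min_y(u_{\mathsf F}\cdot y-h(\mathsf S,u_{\mathsf F}))$ over vertices $y\notin\mathsf F$ joined by an edge to a vertex of $\mathsf F$. These truncations do not depend on the choice of the $u_{\mathsf G}$. Building sets. A set $\mathrm B$ of nonempty proper faces of a simple polytope $\mathsf S$ is a building set for $\mathsf S$ if it contains all facets and, whenever $\mathsf F,\mathsf G\in\mathrm B$ satisfy $\mathsf F\cap\mathsf G\ne\emptyset$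 and some facet contains both, $\mathsf F\cap\mathsf G\in\mathrm B$. A $\mathrm B$-truncation of $\mathsf S$ is a polytope $\mathsf S_m$ obtained by listing $\mathrm B$ as $\mathsf F_1,\dots,\mathsf F_m$ in an order extending inclusion (smaller faces first) and setting $\mathsf S_0=\mathsf S$, $\mathsf S_i=\operatorname{Tr}_{\epsilon_i}[\mathsf S_{i-1},\mathsf F_i\cap\mathsf S_{i-1}]$ (direction $u_{\mathsf F_i}$) with every truncation shallow. Nestohedra. The $0$-nestohedron is the standard simplex $\Delta_n=\operatorname{conv}\{e_1,\dots,e_n\}$. For $k\ge1$, $\mathsf P$ is a $k$-nestohedron if it is a $\mathrm B$-truncation of some $(k-1)$-nestohedron $\mathsf Q$ for some building set $\mathrm B$ on $\mathsf Q$. Deformation cones in a common space. For a flag $\mathcal F$: $\emptyset\subsetneq T_1\subsetneq\dots\subsetneq T_m\subsetneq[n]$, $m\ge1$, let $u_{\mathcal F}=\sum_j e_{T_j}$, where $e_T=\sum_{i\in T}e_i$; the rays of the $2$-braid fan (second barycentric subdivision of $\Sigma(\Delta_n)$) are $\operatorname{Cone}(u_{\mathcal F})+\mathbb R e_{[n]}$, and every ray of the normal fan of a $2$-nestohedron is one of these. The deformation cone of a polytope $\mathsf P$ is the set of support functions of polytopes $\mathsf Q$ whose normal fan coarsens $\Sigma(\mathsf P)$ (each cone of $\Sigma(\mathsf Q)$ is a union of cones of $\Sigma(\mathsf P)$). For a $2$-nestohedron $\mathsf P$ it is viewed as a polyhedral cone in the finite-dimensional space of real functions on $\mathbf U=\{u_{\mathcal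 F}\}_{\mathcal F}\cup\{e_{[n]}\}$ via $\mathsf Q\mapsto(h(\mathsf Q,u))_{u\in\mathbf U}$. A fan is a finite set of polyhedral cones closed under taking faces in which any two cones intersect in a common face (cones may have lineality). *)

(* Defs.v *)
From HB Require Import structures.
From mathcomp Require Import all_boot all_order all_algebra.
From mathcomp Require Import all_classical all_reals.

Set Implicit Arguments.
Unset Strict Implicit.
Unset Printing Implicit Defensive.

Import Order.TTheory GRing.Theory Num.Theory.

Local Open Scope card_scope.
Local Open Scope classical_set_scope.
Local Open Scope ring_scope.

Section Polytopes.
Context {R : realType} {n : nat}.
Implicit Types (P Q S F G : set 'rV[R]_n) (u w x y : 'rV[R]_n).

Definition dot u x : R := \sum_(i < n) u 0 i * x 0 i.

Definition conv m (p : 'I_m -> 'rV[R]_n) : set 'rV[R]_n :=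
  [set x | exists l : 'I_m -> R,
     [/\ forall i, 0 <= l i, \sum_i l i = 1 & x = \sum_i l i *: p i]].

(* Polytopes are nonempty here, so that their support functions are finite. *)
Definition polytope P := exists m (p : 'I_m.+1 -> 'rV[R]_n), P = conv p.

(* The infimum is attained when P is a polytope. *)
Definition h P u : R := inf [set dot u x | x in P].

Definition lineality P : set 'rV[R]_n :=
  [set w | exists c, forall x, P x -> dot w x = c].

(* Nonempty faces only; P is a face of itself (take u = 0). *)
Definition face P F := exists u, F = [set x | P x /\ dot u x = h P u].

Definition proper_face P F := face P F /\ F <> P.

(* The largest d such that A contains d + 1 affinely independent points
   x0, x0 + s_1, ..., x0 + s_d (and 0 when A is empty). *)
Definition aff_dim (A : set 'rV[R]_n) : nat :=
  \max_(d < n.+1 | `[< exists x0 (s : d.-tuple 'rV[R]_n),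
      [/\ A x0, forall v, v \in s -> A (x0 + v) & free s] >]) d.

Definition vertex P x := face P [set x].

Definition edge P F := face P F /\ aff_dim F = 1%N.

Definition facet P F := face P F /\ (aff_dim F).+1 = aff_dim P.

Definition simple_polytope P :=
  polytope P /\
  forall x, vertex P x -> [set G | facet P G /\ G x] #= `I_(aff_dim P).

Definition normal_cone P F : set 'rV[R]_n :=
  [set u | forall x, F x -> dot u x = h P u].

Definition normal_fan P : set (set 'rV[R]_n) :=
  [set normal_cone P F | F in face P].

Definition coarsens (Sigma Sigma' : set (set 'rV[R]_n)) :=
  forall C, Sigma C ->
    exists2 D : set (set 'rV[R]_n), D `<=` Sigma' & C = \bigcup_(K in D) K.

Definition lattice : set 'rV[R]_n := [set w | forall i, w 0 i \is a Num.int].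

(* The class of w in Z^n / (Z^n \cap L) is primitive. *)
Definition primitive_mod (L : set 'rV[R]_n) w :=
  [/\ lattice w, ~ L w &
    forall (k : nat) w', (1 < k)%N -> lattice w' -> ~ L (w - w' *+ k)].

Definition facet_normals S (u : set 'rV[R]_n -> 'rV[R]_n) :=
  forall G, facet S G ->
    normal_cone S G (u G) /\ primitive_mod (lineality S) (u G).

Definition face_normal S (u : set 'rV[R]_n -> 'rV[R]_n) F : 'rV[R]_n :=
  \sum_(G \in [set G | facet S G /\ F `<=` G]) u G.

Definition truncation S u (eps : R) : set 'rV[R]_n :=
  [set x | S x /\ h S u + eps <= dot u x].

(* F must be a nonempty proper face of S for a truncation at F to make sense. *)
Definition shallow S F u (eps : R) :=
  [/\ proper_face S F, 0 < eps &
  forall x y E, vertex S x -> vertex S y -> edge S E -> E x -> E y ->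
    F x -> ~ F y -> eps < dot u y - h S u].

Definition building_set S (B : set (set 'rV[R]_n)) :=
  [/\ simple_polytope S,
      B `<=` proper_face S,
      facet S `<=` B &
      forall F G, B F -> B G -> F `&` G !=set0 ->
        (exists H, [/\ facet S H, F `<=` H & G `<=` H]) -> B (F `&` G)].

(* All directions are computed in the initial polytope S, from one choice u of
   facet normals; the truncations do not depend on that choice. *)
Definition B_truncation S (B : set (set 'rV[R]_n)) P :=
  exists (u : set 'rV[R]_n -> 'rV[R]_n) (m : nat)
         (F : 'I_m -> set 'rV[R]_n) (eps : 'I_m -> R) (T : nat -> set 'rV[R]_n),
    [/\ facet_normals S u,
        [/\ injective F, range F = B
          & forall i j : 'I_m, F i `<=` F j -> (i <= j)%N],
        T 0%N = S,
        forall i : 'I_m,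
          shallow (T i) (F i `&` T i) (face_normal S u (F i)) (eps i) /\
          T i.+1 = truncation (T i) (face_normal S u (F i)) (eps i)
      & P = T m].

Definition std_simplex : set 'rV[R]_n := conv (fun i : 'I_n => delta_mx 0 i).

Fixpoint nestohedron (k : nat) : set (set 'rV[R]_n) :=
  if k is k'.+1 then
    [set P | exists Q B,
       [/\ nestohedron k' Q, building_set Q B & B_truncation Q B P]]
  else [set std_simplex].

Definition ind_vec (T : {set 'I_n}) : 'rV[R]_n := \row_i (i \in T)%:R.

(* A flag is encoded as the set of its members. *)
Definition is_flag (F : {set {set 'I_n}}) : bool :=
  [&& F != finset.set0,
      [forall T in F, (T != finset.set0) && (T != [set: 'I_n]%SET)] &
      [forall T in F, forall T' in F, (T \subset T') || (T' \subset T)]].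

Definition flag_vec (F : {set {set 'I_n}}) : 'rV[R]_n :=
  \sum_(T in F) ind_vec T.

Definition braid_vecs : seq 'rV[R]_n :=
  ind_vec [set: 'I_n]%SET :: map flag_vec (enum is_flag).

Definition support_vec Q : {ffun seq_sub braid_vecs -> R} :=
  [ffun u => h Q (val u)].

Definition deformation_cone P : set {ffun seq_sub braid_vecs -> R} :=
  [set support_vec Q | Q in
    [set Q | polytope Q /\ coarsens (normal_fan Q) (normal_fan P)]].

End Polytopes.

Arguments nestohedron R n k : clear implicits.

Section Fans.
Context {R : realType} {I : finType}.
Implicit Types (C D F : set {ffun I -> R}).

Definition pairing (a x : {ffun I -> R}) : R := \sum_i a i * x i.

Definition polyhedral_cone C :=
  exists s : seq {ffun I -> R},
    C = [set x | forall a, a \in s -> 0 <= pairing a x].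

Definition cone_face C F :=
  exists2 a, (forall x, C x -> 0 <= pairing a x) &
    F = [set x | C x /\ pairing a x = 0].

Definition is_fan (Sigma : set (set {ffun I -> R})) :=
  [/\ finite_set Sigma,
      Sigma `<=` polyhedral_cone,
      forall C F, Sigma C -> cone_face C F -> Sigma F &
      forall C D, Sigma C -> Sigma D ->
        cone_face C (C `&` D) /\ cone_face D (C `&` D)].

Definition with_faces (Sigma : set (set {ffun I -> R})) :=
  Sigma `|` [set F | exists2 C, Sigma C & cone_face C F].

End Fans.

(* Main.v *)
From HB Require Import structures.
Require Import Defs.
From mathcomp Require Import all_boot all_order all_algebra.
From mathcomp Require Import all_classical all_reals.
From mathcomp Require Import ring lra zify.

Set Implicit Arguments.
Unset Strict Implicit.
Unset Printing Implicit Defensive.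

Import Order.TTheory GRing.Theory Num.Theory.

Local Open Scope classical_set_scope.
Local Open Scope ring_scope.

(** Why the deformation cones form a fan. Let [U] be the set of flag vectors,
    together with the all-ones vector [one].

    The argument applies to any collection of nonempty polytopes [P] that are cut
    out by inequalities [u . x >= f u], [u] in [U], in a hyperplane where
    [one . x] is constant ([Uform]). A function [g] on [U] belongs to the
    deformation cone of such a [P] if and only if each point [x] of [P] has a
    counterpart [y] with [u . y >= g u] for all [u], and equality for all [u] that
    are minimized over [P] at [x] ([deformation_coneE]). Three consequences follow.
    The cone depends only on the finite family of the sets of functionals that
    are minimized at the points of [P], so there are finitely many cones. At a
    vertex the counterpart is a linear function of [g], so the cone is polyhedral
    ([deforms_poly]). Finally, if [g] and [g'] are deformations of [P] whose sum is
    a deformation of [P'], then [g] is a deformation of [P']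
    ([deformation_summand]); hence the common part of the two cones absorbs
    summands, which makes it a face of each of them ([face_criterion]). Adding the
    faces of the cones then gives a fan ([with_faces_fan], [deformation_fan]).

    What remains is that 2-nestohedra satisfy [Uform], that is, that they are
    obtained from the simplex by cutting in directions that are flag vectors modulo
    [one] ([nestohedron2]). A 1-nestohedron is described by inequalities
    [e_T . x >= c T], one for each set [T] of the building set. A shallow truncation
    cuts off no vertex outside of the truncated face ([shallow_vertex], by the
    simplex method); therefore every one of these inequalities keeps defining a
    facet ([stage_irr]), and facets that meet belong to nested or disjoint sets
    ([stage_laminar]). If [N] is the family of the sets whose facets contain a given
    face, then no member of [N] is the union of smaller members, since otherwise
    its inequality would be the sum of theirs and would not define a facet. Hence
    the sets of the indices that lie in at least 1, 2, 3, ... members of [N] form a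
    strict chain, and the truncation direction, which is the sum of the [e_T] with
    [T] in [N], is the vector of that flag ([nested_flag], [nested_direction]). *)

(** * The dot product *)

Section Dot.
Context {R : realType} {n : nat}.
Implicit Types (u v w x y d : 'rV[R]_n).

Lemma dotC u x : dot u x = dot x u.
Proof. by apply: eq_bigr => i _; rewrite mulrC. Qed.

Lemma dotDr u x y : dot u (x + y) = dot u x + dot u y.
Proof. by rewrite -big_split; apply: eq_bigr => i _; rewrite mxE mulrDr. Qed.

Lemma dotZr u a x : dot u (a *: x) = a * dot u x.
Proof. by rewrite big_distrr; apply: eq_bigr => i _; rewrite mxE mulrCA. Qed.

Lemma dotDl u v x : dot (u + v) x = dot u x + dot v x.
Proof. by rewrite !(dotC _ x) dotDr. Qed.

Lemma dotZl a u x : dot (a *: u) x = a * dot u x.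
Proof. by rewrite !(dotC _ x) dotZr. Qed.

Lemma dotNr u x : dot u (- x) = - dot u x.
Proof. by rewrite -scaleN1r dotZr mulN1r. Qed.

Lemma dotNl u x : dot (- u) x = - dot u x.
Proof. by rewrite -scaleN1r dotZl mulN1r. Qed.

Lemma dotBr u x y : dot u (x - y) = dot u x - dot u y.
Proof. by rewrite dotDr dotNr. Qed.

Lemma dot0r u : dot u 0 = 0.
Proof. by rewrite -(scale0r 0) dotZr mul0r. Qed.

Lemma dot0l x : dot 0 x = 0.
Proof. by rewrite dotC dot0r. Qed.

Lemma dot_suml (I : Type) (r : seq I) (P : pred I) (F : I -> 'rV[R]_n) x :
  dot (\sum_(i <- r | P i) F i) x = \sum_(i <- r | P i) dot (F i) x.
Proof.
by apply: (big_ind2 (fun u s => dot u x = s)) => //;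
  [exact: dot0l | move=> u a v b <- <-; exact: dotDl].
Qed.

Lemma dot_sumr (I : Type) (r : seq I) (P : pred I) (F : I -> 'rV[R]_n) u :
  dot u (\sum_(i <- r | P i) F i) = \sum_(i <- r | P i) dot u (F i).
Proof. by rewrite dotC dot_suml; apply: eq_bigr => i _; rewrite dotC. Qed.

Lemma dot_delta u i : dot u (delta_mx 0 i) = u 0 i.
Proof.
rewrite /dot (bigD1 i) //= mxE !eqxx mulr1 big1 ?addr0 // => j ji.
by rewrite mxE (negbTE ji) andbF mulr0.
Qed.

End Dot.

(** * Selection lemmas for finite systems *)

Lemma count_lt (T : eqType) (p q : pred T) (s : seq T) (c : T) :
  {in s, forall a, p a -> q a} -> c \in s -> q c -> ~~ p c ->
  (count p s < count q s)%N.
Proof.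
move=> pq cs qc pc; elim: s pq cs => // a s IH pq.
have pqs : {in s, forall b, p b -> q b}.
  by move=> b bs; apply: pq; rewrite inE bs orbT.
rewrite inE => /orP[/eqP ca|cs] /=; last first.
  by rewrite -addnS leq_add ?IH //; case: (p a) (pq a (mem_head _ _)) => // ->.
rewrite -ca qc (negbTE pc) add0n add1n ltnS.
elim: s pqs {IH pq} => // b s IH pqs /=; apply: leq_add.
  by case: (p b) (pqs b (mem_head _ _)) => // ->.
by apply: IH => d ds; apply: pqs; rewrite inE ds orbT.
Qed.

(** In a set closed under an operation that can only lose tight constraints, some
    point has no other tight constraints than those that all points share. With
    midpoints or sums as the operation, this is a relative interior point. *)
Lemma min_tight (X : Type) (Y : eqType) (A : set X) (s : seq Y)
    (tgt : Y -> X -> bool) (op : X -> X -> X) :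
  A !=set0 ->
  (forall x y, A x -> A y -> A (op x y)) ->
  (forall x y c, A x -> A y -> c \in s -> tgt c (op x y) -> tgt c x && tgt c y) ->
  exists2 z, A z & forall x c, A x -> c \in s -> tgt c z -> tgt c x.
Proof.
move=> [x0 Ax0] Aop top.
have [k] := ubnP (count (tgt^~ x0) s); elim: k x0 Ax0 => // k IH x Ax.
rewrite ltnS => hk.
have [[y [Ay lt]]|no] := pselect (exists y, A y /\
    (count (tgt^~ y) s < count (tgt^~ x) s)%N).
  exact: (IH y Ay (leq_trans lt hk)).
exists x => // y c Ay cs tc; apply/negPn/negP => nt; apply: no.
exists (op x y); split; first exact: Aop.
apply: (@count_lt _ _ _ _ c) => // [a aS /(top _ _ _ Ax Ay aS)/andP[]//|].
by apply/negP => /(top _ _ _ Ax Ay cs)/andP[_]; apply/negP.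
Qed.

(** Finitely many affine functions of one variable that are nonnegative at 0,
    and nondecreasing when they vanish there, stay nonnegative for a while. *)
Lemma small_step (R : realType) (Y : eqType) (s : seq Y) (p q : Y -> R) :
  {in s, forall c, 0 <= p c} -> {in s, forall c, p c = 0 -> 0 <= q c} ->
  exists2 e : R, 0 < e & {in s, forall c, 0 <= p c + e * q c}.
Proof.
elim: s => [|a s IH] hp hq; first by exists 1.
have [||e e0 he] := IH.
- by move=> c cs; apply: hp; rewrite inE cs orbT.
- by move=> c cs; apply: hq; rewrite inE cs orbT.
have pa := hp a (mem_head _ _); have qa := hq a (mem_head _ _).
have [q0|q0] := leP 0 (q a).
  exists e => // c; rewrite inE => /orP[/eqP->|/he//].
  by rewrite addr_ge0 // mulr_ge0 // ltW.
have p0 : 0 < p a.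
  rewrite lt_neqAle pa andbT eq_sym; apply/eqP => /qa.
  by rewrite leNgt q0.
pose e' := p a / (- q a).
have e'0 : 0 < e' by rewrite divr_gt0 // oppr_gt0.
have key f : 0 < f -> f <= e' -> 0 <= p a + f * q a.
  move=> f0 /ler_wpM2r -/(_ (- q a)); rewrite oppr_ge0 => /(_ (ltW q0)).
  rewrite /e' divfK ?oppr_eq0 ?lt_eqF //; lra.
have key2 f : 0 < f -> f <= e -> {in s, forall c, 0 <= p c + f * q c}.
  move=> f0 fe c cs; have := he c cs.
  have pc : 0 <= p c by apply: hp; rewrite inE cs orbT.
  have [qc _|qc] := leP 0 (q c); first by rewrite addr_ge0 // mulr_ge0 // ltW.
  by move/le_trans; apply; rewrite lerD2l ler_wnM2r // ltW.
exists (Num.min e e'); first by rewrite lt_min e0 e'0.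
have m0 : 0 < Num.min e e' by rewrite lt_min e0 e'0.
move=> c; rewrite inE => /orP[/eqP->|cs].
  by apply: key => //; rewrite ge_min lexx orbT.
by apply: key2 => //; rewrite ge_min lexx.
Qed.

Lemma seq_argmin (R : realType) (Y : eqType) (f : Y -> R) (s : seq Y) x0 :
  x0 \in s -> exists2 z, z \in s & {in s, forall y, f z <= f y}.
Proof.
elim: s x0 => // a s IH x0 _.
case: s IH => [_|b s /(_ b (mem_head _ _))[z zs mz]].
  by exists a; rewrite ?mem_head // => y; rewrite inE => /eqP->.
have [az|za] := leP (f a) (f z).
  exists a; rewrite ?mem_head // => y; rewrite in_cons => /orP[/eqP->//|/mz].
  exact: le_trans.
exists z => [|y]; first by rewrite in_cons zs orbT.
by rewrite in_cons => /orP[/eqP->|/mz//]; exact: ltW.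
Qed.

(** * Polyhedra given by inequalities *)

Section HPoly.
Context {R : realType} {n : nat}.
Implicit Types (u v w x y z d : 'rV[R]_n) (c : 'rV[R]_n * R).
Implicit Types (s : seq ('rV[R]_n * R)).

(** The solution set of the inequalities [a . x >= b], for [(a, b)] in [s]. *)
Definition hpoly s : set 'rV[R]_n :=
  [set x | forall c, c \in s -> c.2 <= dot c.1 x].

(** The constraint [c] holds with equality at [x]. *)
Definition tight c x := dot c.1 x == c.2.

(** The recession cone of the system is trivial. *)
Definition bounded_sys s :=
  forall d, (forall c, c \in s -> 0 <= dot c.1 d) -> d = 0.

(** The constraints that are tight at [x] determine [x]. *)
Definition basic s x :=
  forall d, (forall c, c \in s -> tight c x -> dot c.1 d = 0) -> d = 0.

(** The points of [P] where [u] attains its minimum over [P]; this set is empty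
    when the minimum is not attained. *)
Definition argmin (P : set 'rV[R]_n) u :=
  [set x | P x /\ forall y, P y -> dot u x <= dot u y].

Lemma hpoly_cat s s' : hpoly (s ++ s') = hpoly s `&` hpoly s'.
Proof.
apply/seteqP; split=> x.
  by move=> Px; split=> c cs; apply: Px; rewrite mem_cat cs ?orbT.
by move=> [Px Px'] c; rewrite mem_cat => /orP[/Px|/Px'].
Qed.

(** A direction along which no tight constraint decreases is feasible. *)
Lemma hpoly_step s x d : hpoly s x ->
  (forall c, c \in s -> tight c x -> 0 <= dot c.1 d) ->
  exists2 e : R, 0 < e & hpoly s (x + e *: d).
Proof.
move=> Px hd.
have [|c cs E|e e0 he] := @small_step R _ s
    (fun c => dot c.1 x - c.2) (fun c => dot c.1 d).
- by move=> c cs; rewrite subr_ge0; exact: Px.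
- by apply: hd => //; rewrite /tight -subr_eq0 E.
exists e => // c cs; have := he c cs; rewrite dotDr dotZr; lra.
Qed.

(** From [x] one can move along [d] until a constraint blocks. *)
Lemma max_step s x d : hpoly s x ->
  (forall c, c \in s -> 0 <= dot c.1 d) \/
  exists t c, [/\ 0 <= t, hpoly s (x + t *: d), c \in s, dot c.1 d < 0
    & tight c (x + t *: d)].
Proof.
elim: s => [|a s IH] Px; first by left.
have Pa : a.2 <= dot a.1 x by apply: Px; rewrite mem_head.
have Ps : hpoly s x by move=> c cs; apply: Px; rewrite inE cs orbT.
have [ad|ad] := leP 0 (dot a.1 d).
  case: (IH Ps) => [hs|[t [c [t0 Pt cs cd ct]]]].
    by left=> c; rewrite inE => /orP[/eqP->|/hs].
  right; exists t, c; split=> //; last by rewrite inE cs orbT.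
  move=> b; rewrite inE => /orP[/eqP->|/Pt//].
  by rewrite dotDr dotZr (le_trans Pa) // lerDl mulr_ge0.
pose r := (dot a.1 x - a.2) / (- dot a.1 d).
have r0 : 0 <= r by rewrite divr_ge0 ?subr_ge0 // oppr_ge0 ltW.
have ra : dot a.1 (x + r *: d) = a.2.
  by rewrite dotDr dotZr /r; field; rewrite lt_eqF.
case: (IH Ps) => [hs|[t [c [t0 Pt cs cd ct]]]].
  right; exists r, a; split=> //; rewrite ?mem_head ?/tight ?ra //.
  move=> b; rewrite inE => /orP[/eqP->|bs]; first by rewrite ra.
  by rewrite dotDr dotZr (le_trans (Ps _ bs)) // lerDl mulr_ge0 // hs.
have [tr|rt] := leP t r.
  right; exists t, c; split=> //; last by rewrite inE cs orbT.
  move=> b; rewrite inE => /orP[/eqP->|/Pt//].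
  by rewrite -ra !dotDr !dotZr lerD2l ler_wnM2r // ltW.
right; exists r, a; split=> //; rewrite ?mem_head ?/tight ?ra //.
move=> b; rewrite inE => /orP[/eqP->|bs]; first by rewrite ra.
have := Ps _ bs; have := Pt _ bs; rewrite !dotDr !dotZr.
have [bd _ B|bd B _] := leP 0 (dot b.1 d).
  by rewrite (le_trans B) // lerDl mulr_ge0.
by rewrite (le_trans B) // lerD2l ler_wnM2r ?ltW.
Qed.

Lemma hE (P : set 'rV[R]_n) u x : argmin P u x -> h P u = dot u x.
Proof.
move=> [Px mx]; apply/eqP; rewrite eq_le; apply/andP; split.
  apply: ge_inf; last by exists x.
  by exists (dot u x) => _ [y Py <-]; exact: mx.
by apply: lb_le_inf; [exists (dot u x), x | move=> _ [y Py <-]; exact: mx].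
Qed.

Lemma argmin_h (P : set 'rV[R]_n) u x : argmin P u !=set0 ->
  P x -> dot u x = h P u -> argmin P u x.
Proof.
move=> [y my] Px xh; split=> // z Pz; rewrite xh (hE my).
exact: my.2.
Qed.

Lemma argmin_face (P : set 'rV[R]_n) u : argmin P u !=set0 -> face P (argmin P u).
Proof.
move=> ne; exists u; apply/seteqP; split=> x.
  by move=> mx; split; [exact: mx.1 | rewrite (hE mx)].
by case=> Px E; exact: argmin_h.
Qed.

Lemma h_le (P : set 'rV[R]_n) u x : argmin P u !=set0 -> P x -> h P u <= dot u x.
Proof. by move=> [y my] Px; rewrite (hE my); exact: my.2. Qed.

(** Making some tight constraints equalities cuts out a face. *)
Lemma tight_face s (p : pred ('rV[R]_n * R)) x : hpoly s x ->
  (forall c, c \in s -> p c -> tight c x) ->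
  face (hpoly s) [set y | hpoly s y /\ forall c, c \in s -> p c -> tight c y].
Proof.
move=> Px px; set K := [set y | _].
suff -> : K = argmin (hpoly s) (\sum_(c <- s | p c) c.1).
  apply: argmin_face; exists x; split=> // y Py; rewrite !dot_suml.
  rewrite big_seq_cond [leRHS]big_seq_cond; apply: ler_sum => c /andP[cs pc].
  by rewrite (eqP (px c cs pc)) Py.
have sx : dot (\sum_(c <- s | p c) c.1) x = \sum_(c <- s | p c) c.2.
  rewrite dot_suml big_seq_cond [RHS]big_seq_cond; apply: eq_bigr => c.
  by case/andP=> cs pc; exact/eqP/px.
have mx : argmin (hpoly s) (\sum_(c <- s | p c) c.1) x.
  split=> // z Pz; rewrite sx dot_suml.
  rewrite big_seq_cond [leRHS]big_seq_cond; apply: ler_sum => c /andP[cs pc].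
  exact: Pz.
apply/seteqP; split=> y.
  case=> Py py; apply: argmin_h => //; first by exists x.
  rewrite (hE mx) sx dot_suml big_seq_cond [RHS]big_seq_cond.
  by apply: eq_bigr => c /andP[cs pc]; exact/eqP/py.
move=> my; have Py := my.1; split=> // c cs pc.
have /eqP : dot (\sum_(c <- s | p c) c.1) y - \sum_(c <- s | p c) c.2 = 0.
  by rewrite -sx -(hE mx) -(hE my) subrr.
rewrite dot_suml -sumrB big_seq_cond psumr_eq0 => [|a /andP[aS _]]; last first.
  by rewrite subr_ge0 Py.
by move/allP/(_ _ cs); rewrite cs pc /= subr_eq0.
Qed.

(** With [vertex_basic] below, the vertices of a bounded polyhedron are its basic
    points. *)
Lemma basic_vertex s x : hpoly s x -> basic s x -> vertex (hpoly s) x.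
Proof.
move=> Px bx.
have := @tight_face s (fun c => tight c x) x Px (fun c _ t => t).
rewrite /vertex; congr (face _ _); apply/seteqP; split=> [y|y ->] //=.
case=> Py ty; apply/eqP; rewrite -subr_eq0; apply/eqP/bx => c cs tc.
by rewrite dotBr (eqP tc) (eqP (ty c cs tc)) subrr.
Qed.

Lemma vertex_in (P : set 'rV[R]_n) x : vertex P x -> P x.
Proof. by case=> u E; have : [set x] x by []; rewrite E => -[]. Qed.

Lemma face_in (P F : set 'rV[R]_n) x : face P F -> F x -> P x.
Proof. by case=> u -> []. Qed.

(** A linear functional can be decreased down to a vertex, without leaving any
    of the constraints that are tight at the start. *)
Lemma basic_below s x v : bounded_sys s -> hpoly s x ->
  exists z, [/\ hpoly s z, basic s z, dot v z <= dot v x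
    & forall c, c \in s -> tight c x -> tight c z].
Proof.
move=> bs; have [k] := ubnP (size s - count (tight^~ x) s); elim: k x => // k IH.
move=> x; rewrite ltnS => hk Px.
have [bx|nb] := pselect (basic s x); first by exists x.
have [d [td d0]] : exists d, (forall c, c \in s -> tight c x -> dot c.1 d = 0)
    /\ d <> 0.
  by apply: contrapT => no; apply: nb => d td; apply: contrapT => d0;
    apply: no; exists d.
wlog vd : d td d0 / dot v d <= 0.
  move=> W; have [/W|vd] := leP (dot v d) 0; first exact.
  apply: (W (- d)); rewrite ?dotNr ?oppr_le0 ?(ltW vd) //.
    by move=> c cs tc; rewrite dotNr td // oppr0.
  by move/eqP; rewrite oppr_eq0 => /eqP.
case: (max_step d Px) => [/bs//|[t [c [t0 Pt cs cd ct]]]].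
have tt : forall b, b \in s -> tight b x -> tight b (x + t *: d).
  by move=> b bS tb; rewrite /tight dotDr dotZr (td b bS tb) mulr0 addr0.
have ntc : ~~ tight c x.
  by apply/negP => tc; move: cd; rewrite (td c cs tc) ltxx.
have lt := count_lt tt cs ct ntc.
have [|//|z [Pz bz vz tz]] := IH (x + t *: d).
  apply: leq_trans hk; rewrite ltn_sub2l //.
  by rewrite (leq_trans lt) ?count_size.
exists z; split=> //; last by move=> b bS tb; apply: tz => //; exact: tt.
by rewrite (le_trans vz) // dotDr dotZr gerDl mulr_ge0_le0.
Qed.

(** Basic points are determined by their tight constraints. *)
Lemma finite_basic s : finite_set [set x | hpoly s x /\ basic s x].
Proof.
pose m x := [ffun i : 'I_(size s) => tight (nth (0, 0) s i) x].
pose g f := xget 0 [set x | [/\ hpoly s x, basic s x & m x = f]].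
apply: (@sub_finite_set _ _ (range g)); last exact/finite_image/finite_finset.
move=> x [Px bx]; exists (m x) => //; rewrite /g.
case: xgetP => [y _ [Py _ E]|/(_ x)]; last by case.
apply/eqP; rewrite eq_sym -subr_eq0; apply/eqP/bx => c cs tc.
rewrite dotBr (eqP tc); suff /eqP -> : tight c y by rewrite subrr.
move/ffunP: E; have ci := cs; rewrite -index_mem in ci.
by move/(_ (Ordinal ci)); rewrite !ffunE /= nth_index // tc.
Qed.

(** The minimum is attained, because it may be searched among the basic points. *)
Lemma argmin_ex s u : bounded_sys s -> hpoly s !=set0 ->
  argmin (hpoly s) u !=set0.
Proof.
move=> bs [x0 P0]; have /finite_seqP[vs vsE] := finite_basic s.
have [z0 [P00 b0 _ _]] := basic_below u bs P0.
have z0vs : z0 \in vs by have : [set` vs] z0 by rewrite -vsE.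
have [z zvs mz] := seq_argmin (dot u) z0vs.
have [Pz bz] : [set x | hpoly s x /\ basic s x] z by rewrite vsE.
exists z; split=> // y Py; have [y' [Py' by' yy _]] := basic_below u bs Py.
apply: le_trans yy; apply: mz.
by have : [set` vs] y' by rewrite -vsE.
Qed.

Lemma vertex_basic s x :
  bounded_sys s -> vertex (hpoly s) x -> basic s x.
Proof.
move=> bs vx d hd; have Px := vertex_in vx; case: vx => u E.
have xh : dot u x = h (hpoly s) u by have : [set x] x by []; rewrite E => -[].
have mx : argmin (hpoly s) u x.
  by apply: argmin_h => //; apply: argmin_ex => //; exists x.
have [e e0 Pe] : exists2 e : R, 0 < e & hpoly s (x + e *: d).
  by apply: hpoly_step => // c cs /(hd c cs) ->.
have [f f0 Pf] : exists2 e : R, 0 < e & hpoly s (x + e *: (- d)).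
  by apply: hpoly_step => // c cs /(hd c cs); rewrite dotNr => ->; rewrite oppr0.
have := mx.2 _ Pe; rewrite dotDr dotZr lerDl pmulr_rge0 // => ud.
have := mx.2 _ Pf; rewrite dotDr dotZr lerDl pmulr_rge0 // dotNr oppr_ge0 => du.
have u0 : dot u d = 0 by apply/eqP; rewrite eq_le ud du.
have : [set x] (x + e *: d).
  by rewrite E; split=> //; rewrite dotDr dotZr u0 mulr0 addr0 (hE mx).
move=> /eqP; rewrite -subr_eq0 addrAC subrr add0r scaler_eq0 gt_eqF //=.
by move/eqP.
Qed.

Lemma face_argmin s F : bounded_sys s -> hpoly s !=set0 -> face (hpoly s) F ->
  exists u, F = argmin (hpoly s) u.
Proof.
move=> bs ne [u ->]; exists u; apply/seteqP; split=> x.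
  by case=> Px E; apply: argmin_h => //; exact: argmin_ex.
by move=> mx; split; [exact: mx.1 | rewrite (hE mx)].
Qed.

(** Among the directions that decrease [u] and are feasible at [x], one with the
    most tight constraints kept spans the direction space of an edge. *)
Lemma edge_direction s x u d : basic s x ->
  (forall c, c \in s -> tight c x -> 0 <= dot c.1 d) -> dot u d < 0 ->
  exists d, [/\ forall c, c \in s -> tight c x -> 0 <= dot c.1 d, dot u d < 0 &
    forall d', (forall c, c \in s -> tight c x -> dot c.1 d = 0 -> dot c.1 d' = 0)
      -> exists k, d' = k *: d].
Proof.
move=> bx.
pose s0 : seq ('rV[R]_n * R) := [seq (c.1, 0) | c <- s & tight c x].
have s0P d0 : (forall c, c \in s -> tight c x -> 0 <= dot c.1 d0) <-> hpoly s0 d0.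
  split=> [hd b /mapP[c]|hd c cs tc].
    by rewrite mem_filter => /andP[tc cs] -> /=; exact: hd.
  have /(_ _)/= := hd (c.1, 0); apply; apply/mapP; exists c => //.
  by rewrite mem_filter tc.
have [k] := ubnP (size s0 - count (tight^~ d) s0).
elim: k d => // k IH d; rewrite ltnS => hk /s0P Pd ud.
have [one|] := pselect (forall d',
    (forall c, c \in s -> tight c x -> dot c.1 d = 0 -> dot c.1 d' = 0)
      -> exists k, d' = k *: d).
  by exists d; split=> //; exact/s0P.
move=> /existsNP[d' /not_implyP[td' nd']].
(* Correcting [d'] by a multiple of [d] makes it orthogonal to [u]; moving from
   [d] along the result, in either direction, does not change the value of [u]. *)
pose w := d' - (dot u d' / dot u d) *: d.
have w0 : w <> 0 by move/subr0_eq => E; apply: nd'; eexists; exact: E.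
have uw : dot u w = 0 by rewrite dotBr dotZr divfK ?subrr // lt_eqF.
have tw c : c \in s -> tight c x -> dot c.1 d = 0 -> dot c.1 w = 0.
  by move=> cs tc cd; rewrite dotBr dotZr cd mulr0 subr0; exact: td'.
have [w1 [uw1 tw1 [c [cs tc cw]]]] : exists w1, [/\ dot u w1 = 0,
    forall c, c \in s -> tight c x -> dot c.1 d = 0 -> dot c.1 w1 = 0 &
    exists c, [/\ c \in s, tight c x & dot c.1 w1 < 0]].
  have [c [cs tc cw]] : exists c, [/\ c \in s, tight c x & dot c.1 w <> 0].
    apply: contrapT => no; apply: w0; apply: bx => c cs tc.
    by apply: contrapT => cw; apply: no; exists c.
  have [cw0|] := ltP (dot c.1 w) 0.
    by exists w; split=> //; exists c.
  rewrite le_eqVlt => /orP[/eqP/esym//|cw0]; exists (- w); split.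
  - by rewrite dotNr uw oppr0.
  - by move=> a aS ta ad; rewrite dotNr tw ?oppr0.
  - by exists c; rewrite dotNr oppr_lt0.
have cs0 : (c.1, 0) \in s0.
  by apply/mapP; exists c => //; rewrite mem_filter tc.
case: (max_step w1 Pd) => [/(_ _ cs0)/=|[t [a [t0 Pt as0 aw ta]]]].
  by rewrite leNgt cw.
have [b /andP[tb bS] Eb] : exists2 b, tight b x && (b \in s) & a = (b.1, 0).
  by case/mapP: as0 => b; rewrite mem_filter; exists b.
apply: (IH (d + t *: w1)); last 2 first.
- exact/s0P.
- by rewrite dotDr dotZr uw1 mulr0 addr0.
have lt : (count (tight^~ d) s0 < count (tight^~ (d + t *: w1)%R) s0)%N.
  apply: (@count_lt _ _ _ _ a) => //.
    move=> b' /mapP[e]; rewrite mem_filter => /andP[te es] ->.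
    rewrite /tight /= dotDr dotZr => /eqP ed.
    by rewrite tw1 // ed mulr0 addr0.
  apply/negP; rewrite /tight Eb /= => /eqP bd.
  by move: aw; rewrite Eb /= tw1 // ltxx.
apply: leq_trans hk; rewrite ltn_sub2l //.
by rewrite (leq_trans lt) ?count_size.
Qed.

(** Bounds for the dimension from the space of directions of [K]. *)
Lemma aff_dim_le (K : set 'rV[R]_n) (V : {vspace 'rV[R]_n}) :
  (forall x y, K x -> K y -> y - x \in V) -> (aff_dim K <= \dim V)%N.
Proof.
move=> KV; apply/bigmax_leqP => d /asboolP[x0 [s [Kx Ks fs]]].
have /eqP <- : \dim <<s>> == d by rewrite -[X in _ == X](size_tuple s).
apply/dimvS/span_subvP => v /Ks Kv.
by have := KV _ _ Kx Kv; rewrite addrC addKr.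
Qed.

Lemma aff_dim_ge (K : set 'rV[R]_n) (V : {vspace 'rV[R]_n}) x0 : K x0 ->
  (forall v, v \in V -> exists2 e : R, e != 0 & K (x0 + e *: v)) ->
  (\dim V <= aff_dim K)%N.
Proof.
move=> K0 KV.
have /boolp.choice[e eP] : forall v, exists a : R,
    v \in V -> a != 0 /\ K (x0 + a *: v).
  move=> v; have [/KV[a a0 Ka]|nv] := boolP (v \in V); first by exists a.
  by exists 0.
have dV : (\dim V < n.+1)%N.
  by rewrite ltnS (leq_trans (dimvS (subvf V))) // dimvf -[leqRHS]mul1n.
apply: (@leq_bigmax_cond _ (fun d : 'I_n.+1 => `[< exists x0 (s : d.-tuple 'rV[R]_n),
      [/\ K x0, forall v, v \in s -> K (x0 + v) & free s] >])
    (@nat_of_ord n.+1) (Ordinal dV)).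
apply/asboolP; exists x0, (map_tuple (fun v => e v *: v) (vbasis V)).
split=> //= [_ /mapP[v vV ->]|]; first by case: (eP _ (vbasis_mem vV)).
apply/freeP => k /= sk i.
have iV j : (vbasis V)`_j \in V \/ (\dim V <= j)%N.
  have [lt|] := ltnP j (\dim V); last by right.
  by left; apply/vbasis_mem/mem_nth; rewrite size_tuple.
have := basis_free (vbasisP V).
move/freeP/(_ (fun i => k i * e (vbasis V)`_i)).
have -> : \sum_(j < \dim V) (k j * e (vbasis V)`_j) *: (vbasis V)`_j = 0.
  rewrite -[RHS]sk; apply: eq_bigr => j _.
  by rewrite -scalerA (nth_map 0) // size_tuple.
move/(_ erefl i)/eqP; rewrite mulf_eq0 => /orP[/eqP//|].
case: (iV i) => [/eP[/negbTE->]//|]; by rewrite leqNgt ltn_ord.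
Qed.

(** A vertex that does not minimize [u] is on an edge along which [u] decreases. *)
Lemma improving_edge s x u y : bounded_sys s -> vertex (hpoly s) x ->
  hpoly s y -> dot u y < dot u x ->
  exists z E, [/\ vertex (hpoly s) z, edge (hpoly s) E, E x, E z & dot u z < dot u x].
Proof.
move=> bs vx Py uyx; have Px := vertex_in vx; have bx := vertex_basic bs vx.
have [||d [cd ud one]] := @edge_direction s x u (y - x) bx.
- by move=> c cs /eqP tc; rewrite dotBr tc subr_ge0 Py.
- by rewrite dotBr subr_lt0.
have d0 : d <> 0 by move=> E; move: ud; rewrite E dot0r ltxx.
case: (max_step d Px) => [/bs//|[t [b [t0 Pz bS bd tb]]]].
have tn0 : t != 0.
  apply/eqP => E; move: tb; rewrite E scale0r addr0 => tb.
  by have := cd _ bS tb; rewrite leNgt bd.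
have tp : 0 < t by rewrite lt_neqAle eq_sym tn0.
pose p c := tight c x && (dot c.1 d == 0).
pose E := [set z | hpoly s z /\ forall c, c \in s -> p c -> tight c z].
have line z : E z -> exists k, z = x + k *: d.
  move=> [Pz' tz]; have [c cs /eqP tc cd0|k Ek] := one (z - x).
    by rewrite dotBr tc (eqP (tz c cs _)) ?subrr // /p /tight tc cd0 !eqxx.
  by exists k; rewrite -Ek addrC subrK.
have Ex : E x by split=> // c cs /andP[].
have Ez : E (x + t *: d).
  split=> // c cs /andP[/eqP tc /eqP cd0].
  by rewrite /tight dotDr dotZr tc cd0 mulr0 addr0.
exists (x + t *: d), E; split=> //.
- apply: basic_vertex => // d' td'.
  have [|k Ek] := one d'.
    move=> c cs /eqP tc cd0; apply: td' => //.
    by rewrite /tight dotDr dotZr tc cd0 mulr0 addr0.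
  have := td' _ bS tb; rewrite Ek dotZr => /eqP.
  by rewrite mulf_eq0 (lt_eqF bd) orbF => /eqP ->; rewrite scale0r.
- split; first by apply: (@tight_face s p x) => // c cs /andP[].
  have dimd : \dim <[d]> = 1%N by rewrite dim_vline; move/eqP: d0 => ->.
  rewrite -[RHS]dimd; apply/eqP; rewrite eqn_leq; apply/andP; split.
    apply: aff_dim_le => x1 x2 /line[k1 ->] /line[k2 ->].
    rewrite opprD addrACA subrr add0r -scalerBl.
    by rewrite memvZ // memv_line.
  apply: (aff_dim_ge Ex) => _ /vlineP[k ->].
  have [->|k0] := eqVneq k 0.
    by exists 1; rewrite ?oner_neq0 // scale0r scaler0 addr0.
  exists (t / k); first by rewrite mulf_neq0 ?invr_neq0.
  by rewrite scalerA divfK.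
- by rewrite dotDr dotZr gtrDl nmulr_llt0.
Qed.

(** Following improving edges from a vertex outside of a face [argmin v] leads to
    an edge that enters that face. *)
Lemma entering_edge s v y : bounded_sys s -> vertex (hpoly s) y ->
  ~ argmin (hpoly s) v y ->
  exists x z E, [/\ vertex (hpoly s) x, argmin (hpoly s) v x,
    vertex (hpoly s) z & ~ argmin (hpoly s) v z] /\
    [/\ edge (hpoly s) E, E x, E z & dot v z <= dot v y].
Proof.
move=> bs; have /finite_seqP[vs vsE] := finite_basic s.
have vtx z : vertex (hpoly s) z -> z \in vs.
  move=> vz; have : [set` vs] z; last by [].
  by rewrite -vsE; split; [exact: vertex_in | exact: vertex_basic].
have [k] := ubnP (count (fun z => dot v z < dot v y) vs).
elim: k y => // k IH y; rewrite ltnS => hk vy ny.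
have Py := vertex_in vy.
have [y' Py' lt] : exists2 y', hpoly s y' & dot v y' < dot v y.
  have [|z mz] := @argmin_ex s v bs; first by exists y.
  exists z; first exact: mz.1.
  rewrite ltNge; apply/negP => yz; apply: ny; split=> // w Pw.
  exact: le_trans (mz.2 _ Pw).
have [z [E [vz eE Ey Ez zy]]] := improving_edge bs vy Py' lt.
have [mz|nz] := pselect (argmin (hpoly s) v z).
  by exists z, y, E.
have [|//|//|x [z' [E' [H1 [eE' Ex Ez' le]]]]] := IH z.
  apply: leq_trans hk; apply: (@count_lt _ _ _ _ z) => //.
  - by move=> a _ az; exact: lt_trans zy.
  - exact: vtx.
  - by rewrite ltxx.
by exists x, z', E'; split=> //; split=> //; exact: le_trans (ltW zy).
Qed.

(** A shallow truncation at the face where [u] is minimal cuts off no vertex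
    outside of that face, adjacent to it or not. *)
Lemma shallow_vertex s u eps y : bounded_sys s ->
  shallow (hpoly s) (argmin (hpoly s) u) u eps ->
  vertex (hpoly s) y -> ~ argmin (hpoly s) u y -> h (hpoly s) u + eps < dot u y.
Proof.
move=> bs [_ _ sh] vy ny.
have [x [z [E [[vx mx vz nz] [eE Ex Ez le]]]]] := entering_edge bs vy ny.
have := sh _ _ _ vx vz eE Ex Ez mx nz; rewrite ltrBrDl => /lt_le_trans; exact.
Qed.

(** Here [F] need not be the face where [u] is minimal. *)
Lemma shallow_nonempty s F u eps : bounded_sys s -> hpoly s !=set0 ->
  shallow (hpoly s) F u eps -> truncation (hpoly s) u eps !=set0.
Proof.
move=> bs ne [[fF nF] _ sh].
have [v Ev] := face_argmin bs ne fF.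
have [x Px nx] : exists2 x, hpoly s x & ~ F x.
  apply: contrapT => no; apply: nF; apply/seteqP; split=> x.
    exact: face_in.
  by move=> Px; apply: contrapT => nx; apply: no; exists x.
have [y [Py by_ yx _]] := basic_below (- v) bs Px.
have ny : ~ argmin (hpoly s) v y.
  move=> my; apply: nx; rewrite Ev; split=> // z Pz.
  apply: le_trans (my.2 z Pz); move: yx; rewrite !dotNl lerN2 => xy.
  exact: xy.
have [x' [z [E [[vx mx vz nz] [eE Ex Ez _]]]]] :=
  entering_edge bs (basic_vertex Py by_) ny.
exists z; split; first exact: vertex_in.
rewrite -lerBrDl ltW //; apply: (sh x' z E) => //; rewrite Ev //.
Qed.

End HPoly.

(** * Fans made of faces of polyhedral cones *)

Section Cones.
Context {R : realType} {I : finType}.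
Notation V := {ffun I -> R}.
Implicit Types (a b f g x y : V) (s : seq V) (C D E F : set V).

(** The homogeneous counterpart [hcone s] of [hpoly]. *)
Definition hcone s : set V := [set x | forall a, a \in s -> 0 <= pairing a x].

(** Scaling, for real-valued functions. *)
Definition scalef (k : R) x : V := [ffun i => k * x i].

Lemma pairingDr a x y : pairing a (x + y) = pairing a x + pairing a y.
Proof. by rewrite -big_split; apply: eq_bigr => i _; rewrite ffunE mulrDr. Qed.

Lemma pairingDl a b x : pairing (a + b) x = pairing a x + pairing b x.
Proof. by rewrite -big_split; apply: eq_bigr => i _; rewrite ffunE mulrDl. Qed.

Lemma pairingZr a k x : pairing a (scalef k x) = k * pairing a x.
Proof. by rewrite big_distrr; apply: eq_bigr => i _; rewrite ffunE mulrCA. Qed.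

Lemma pairingNl a x : pairing (- a) x = - pairing a x.
Proof. by rewrite -sumrN; apply: eq_bigr => i _; rewrite ffunE mulNr. Qed.

Lemma pairing0l x : pairing 0 x = 0.
Proof. by rewrite /pairing big1 // => i _; rewrite ffunE mul0r. Qed.

Lemma pairing0r a : pairing a 0 = 0.
Proof. by rewrite /pairing big1 // => i _; rewrite ffunE mulr0. Qed.

Lemma pairing_suml s (p : pred V) x :
  pairing (\sum_(a <- s | p a) a) x = \sum_(a <- s | p a) pairing a x.
Proof.
by apply: (big_ind2 (fun a k => pairing a x = k)) => //;
  [exact: pairing0l | move=> a u b v <- <-; exact: pairingDl].
Qed.

Lemma hcone0 s : hcone s 0.
Proof. by move=> a _; rewrite pairing0r. Qed.

Lemma hconeD s x y : hcone s x -> hcone s y -> hcone s (x + y).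
Proof. by move=> cx cy a aS; rewrite pairingDr addr_ge0 ?cx ?cy. Qed.

Lemma hconeZ s k x : 0 <= k -> hcone s x -> hcone s (scalef k x).
Proof. by move=> k0 cx a aS; rewrite pairingZr mulr_ge0 ?cx. Qed.

(** The points of [hcone s] where the constraints satisfying [p] vanish. *)
Definition subface s (p : pred V) : set V :=
  [set x | hcone s x /\ forall a, a \in s -> p a -> pairing a x = 0].

Lemma subface_face s p : cone_face (hcone s) (subface s p).
Proof.
exists (\sum_(a <- s | p a) a) => [x cx|].
  rewrite pairing_suml big_seq_cond sumr_ge0 // => a /andP[aS _]; exact: cx.
apply/seteqP; split=> x [cx]; rewrite /= pairing_suml => h0; split=> //.
  by rewrite big_seq_cond big1 // => a /andP[aS pa]; exact: h0.
move=> a aS pa; move/eqP: h0; rewrite big_seq_cond psumr_eq0.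
  by move=> /allP/(_ a aS); rewrite aS pa => /eqP.
by move=> b /andP[bS _]; exact: cx.
Qed.

(** One can move from [z] in the direction of [- x] inside the cone, if the
    constraints that vanish at [z] also vanish at [x]. *)
Lemma hcone_back s z x : hcone s z -> hcone s x ->
  (forall a, a \in s -> pairing a z = 0 -> pairing a x = 0) ->
  exists2 e : R, 0 < e & hcone s (z + scalef (- e) x).
Proof.
move=> cz cx zx.
have [|a aS az|e e0 he] := @small_step R _ s (pairing^~ z)
    (fun a => - pairing a x); first by move=> a aS; exact: cz.
  by rewrite zx ?oppr0.
by exists e => // a aS; have := he a aS; rewrite pairingDr pairingZr mulNr mulrN.
Qed.

(** Every face is defined by the vanishing of some of the constraints, namely of
    those that vanish at one of its relative interior points. *)
Lemma face_subface s F : cone_face (hcone s) F -> exists p, F = subface s p.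
Proof.
move=> [b bC ->].
have [||x y c [cx _] [cy _] cs|z [cz bz] mz] :=
    @min_tight _ _ [set x | hcone s x /\ pairing b x = 0] s
      (fun a x => pairing a x == 0) +%R.
- by exists 0; split; [exact: hcone0 | exact: pairing0r].
- move=> x y [cx bx] [cy by_]; split; first exact: hconeD.
  by rewrite pairingDr bx by_ addr0.
- by rewrite pairingDr paddr_eq0 ?cx ?cy.
exists (fun a => pairing a z == 0); apply/seteqP; split=> x.
  by move=> [cx bx]; split=> // a aS za; apply/eqP/(mz x a).
move=> [cx zx]; split=> //.
have [a aS /eqP|e e0 ce] := hcone_back cz cx; first exact: zx.
apply/eqP; rewrite eq_le bC // andbT.
have := bC _ ce; rewrite pairingDr bz add0r pairingZr mulNr oppr_ge0.
by rewrite pmulr_rle0.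
Qed.

Lemma subface_hcone s p : subface s p = hcone (s ++ [seq - a | a <- s & p a]).
Proof.
apply/seteqP; split=> x.
  move=> [cx px] a; rewrite mem_cat => /orP[/cx//|/mapP[b]].
  by rewrite mem_filter => /andP[pb bs] ->; rewrite pairingNl px ?oppr0.
move=> cx; have cs : hcone s x by move=> a aS; apply: cx; rewrite mem_cat aS.
split=> // a aS pa; apply/eqP; rewrite eq_le cs // andbT -oppr_ge0 -pairingNl.
by apply: cx; rewrite mem_cat map_f ?orbT // mem_filter pa.
Qed.

Lemma face_poly C F : polyhedral_cone C -> cone_face C F -> polyhedral_cone F.
Proof.
move=> [s ->] /face_subface[p ->]; rewrite subface_hcone.
by exists (s ++ [seq - a | a <- s & p a]).
Qed.

Lemma face_trans C F E : polyhedral_cone C -> cone_face C F -> cone_face F E ->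
  cone_face C E.
Proof.
move=> [s ->] /face_subface[p ->]; rewrite subface_hcone => /face_subface[q ->].
suff -> : subface (s ++ [seq - a | a <- s & p a]) q = subface s (predU p q).
  exact: subface_face.
rewrite /subface -subface_hcone; apply/seteqP; split=> x.
  move=> [[cx px] qx]; split=> // a aS /orP[pa|qa]; first exact: px.
  by apply: qx => //; rewrite mem_cat aS.
move=> [cx pqx].
have px a : a \in s -> p a -> pairing a x = 0.
  by move=> aS pa; apply: pqx => //=; rewrite pa.
split=> // a; rewrite mem_cat => /orP[aS qa|/mapP[b]].
  by apply: pqx => //=; rewrite qa orbT.
by rewrite mem_filter => /andP[pb bs] -> _; rewrite pairingNl px ?oppr0.
Qed.

Lemma face_refl C : cone_face C C.
Proof.
exists 0 => [x _|]; first by rewrite pairing0l.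
by apply/seteqP; split=> [x Cx|x []//]; split=> //; exact: pairing0l.
Qed.

Lemma face_sub C F : cone_face C F -> F `<=` C.
Proof. by move=> [a _ ->] x []. Qed.

(** A face of [C] is also a face of every subset of [C] that contains it. *)
Lemma face_restr C D F : cone_face C F -> F `<=` D -> D `<=` C -> cone_face D F.
Proof.
move=> [a aC ->] FD DC; exists a => [x /DC/aC//|].
apply/seteqP; split=> [x Fx|x [Dx ax]]; last by split=> //; exact: DC.
by split; [exact: FD | case: Fx].
Qed.

Lemma faceI C D F : cone_face C D -> cone_face C F -> cone_face C (D `&` F).
Proof.
move=> [a aC ->] [b bC ->]; exists (a + b) => [x Cx|].
  by rewrite pairingDl addr_ge0 ?aC ?bC.
apply/seteqP; split=> x.
  by move=> [[Cx ax] [_ bx]]; split=> //; rewrite pairingDl ax bx addr0.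
move=> [Cx /eqP]; rewrite pairingDl paddr_eq0 ?aC ?bC // => /andP[/eqP ax /eqP bx].
by [].
Qed.

(** A face of [C] cuts out a face of every subset of [C]. *)
Lemma face_setI C D F : cone_face C F -> D `<=` C -> cone_face D (D `&` F).
Proof.
move=> [a aC ->] DC; exists a => [x /DC/aC//|].
by apply/seteqP; split=> [x [Dx [_ ax]]//|x [Dx ax]]; split=> //; split=> //; exact: DC.
Qed.

Lemma finite_faces C : polyhedral_cone C -> finite_set [set F | cone_face C F].
Proof.
move=> [s ->].
pose g (m : {ffun 'I_(size s) -> bool}) : set V :=
  [set x | hcone s x /\ forall i, m i -> pairing (nth 0 s i) x = 0].
apply: (@sub_finite_set _ _ (range g)); last exact/finite_image/finite_finset.
move=> F /face_subface[p ->]; exists [ffun i : 'I_(size s) => p (nth 0 s i)] => //.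
apply/seteqP; split=> x [cx zx]; split=> //.
  move=> a aS pa; have ai := aS; rewrite -index_mem in ai.
  by have := zx (Ordinal ai); rewrite ffunE /= nth_index //; apply.
by move=> i; rewrite ffunE => pi; apply: zx => //; rewrite mem_nth.
Qed.

(** A subcone is a face as soon as it absorbs the summands of its elements. *)
Lemma face_criterion C E : polyhedral_cone C -> E `<=` C -> E 0 ->
  (forall x y, E x -> E y -> E (x + y)) ->
  (forall k x, 0 < k -> E x -> E (scalef k x)) ->
  (forall x y, C x -> C y -> E (x + y) -> E x) -> cone_face C E.
Proof.
move=> [s ->] EC E0 ED EZ Ef.
have [||x y c /EC cx /EC cy cs|z Ez mz] :=
    @min_tight _ _ E s (fun a x => pairing a x == 0) +%R.
- by exists 0.
- exact: ED.
- by rewrite pairingDr paddr_eq0 ?cx ?cy.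
have cz := EC _ Ez.
suff -> : E = subface s (fun a => pairing a z == 0) by exact: subface_face.
apply/seteqP; split=> x.
  by move=> Ex; split; [exact: EC | move=> a aS za; apply/eqP/(mz x a)].
move=> [cx zx].
have [a aS /eqP|e e0 ce] := hcone_back cz cx; first exact: zx.
have Eex : E (scalef e x).
  apply: (Ef _ (z + scalef (- e) x)) => //; first exact: hconeZ (ltW e0) cx.
  suff -> : scalef e x + (z + scalef (- e) x) = z by [].
  by apply/ffunP => i; rewrite !ffunE mulNr addrCA subrr addr0.
have -> : x = scalef e^-1 (scalef e x).
  by apply/ffunP => i; rewrite !ffunE mulrA mulVf ?mul1r // gt_eqF.
by apply: EZ => //; rewrite invr_gt0.
Qed.

(** Finitely many polyhedral cones and their faces form a fan, if any two of the
    cones intersect in a face of the first (hence also of the second). *)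
Lemma with_faces_fan (Sigma : set (set V)) : finite_set Sigma ->
  Sigma `<=` polyhedral_cone ->
  (forall C D, Sigma C -> Sigma D -> cone_face C (C `&` D)) ->
  is_fan (with_faces Sigma).
Proof.
move=> fin poly cap.
have wf C : with_faces Sigma C <-> exists2 C0, Sigma C0 & cone_face C0 C.
  split=> [[SC|//]|]; last by right.
  by exists C => //; exact: face_refl.
have half C D C0 D0 : Sigma C0 -> Sigma D0 -> cone_face C0 C -> cone_face D0 D ->
    cone_face C (C `&` D).
  move=> SC SD CC DD.
  have fE := cap _ _ SC SD; have fE' := cap _ _ SD SC; rewrite setIC in fE'.
  have f1 : cone_face (C0 `&` D0) (C0 `&` D0 `&` C).
    by apply: (face_setI CC) => x [].
  have f2 : cone_face (C0 `&` D0) (C0 `&` D0 `&` D).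
    by apply: (face_setI DD) => x [].
  have := face_trans (poly _ SC) fE (faceI f1 f2).
  have -> : C0 `&` D0 `&` C `&` (C0 `&` D0 `&` D) = C `&` D.
    apply/seteqP; split=> x; first by move=> [[_ Cx] [_ Dx]].
    move=> [Cx Dx]; have C0x := face_sub CC Cx; have D0x := face_sub DD Dx.
    by [].
  move=> f; apply: (face_restr f); last exact: face_sub.
  by move=> x [].
split.
- rewrite /with_faces finite_setU; split=> //.
  have -> : [set F | exists2 C, Sigma C & cone_face C F] =
      \bigcup_(C in Sigma) [set F | cone_face C F].
    by apply/seteqP; split=> F [C SC CF]; exists C.
  by apply: bigcup_finite => // C SC; exact/finite_faces/poly.
- by move=> C /wf[C0 SC CC]; exact: face_poly (poly _ SC) CC.
- move=> C F /wf[C0 SC CC] CF; apply/wf; exists C0 => //.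
  exact: face_trans (poly _ SC) CC CF.
- move=> C D /wf[C0 SC CC] /wf[D0 SD DD]; split; first exact: (half C D C0 D0).
  by rewrite setIC; exact: (half D C D0 C0).
Qed.

(** Polyhedral cones are stable under finite intersection. *)
Lemma poly_bigcap (T : eqType) (l : seq T) (G : T -> set V) :
  (forall t, t \in l -> polyhedral_cone (G t)) ->
  polyhedral_cone [set x | forall t, t \in l -> G t x].
Proof.
elim: l => [_|t l IH hl]; first by exists [::]; apply/seteqP; split.
have [s1 E1] := hl t (mem_head _ _).
have [|s2 E2] := IH; first by move=> r rl; apply: hl; rewrite inE rl orbT.
exists (s1 ++ s2); apply/seteqP; split=> x.
  move=> xl a; rewrite mem_cat => /orP[aS|aS].
    by have := xl t (mem_head _ _); rewrite E1; apply.
  have : [set x | forall t, t \in l -> G t x] x; last by rewrite E2; apply.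
  by move=> r rl; apply: xl; rewrite inE rl orbT.
move=> cx r; rewrite inE => /orP[/eqP->|rl].
  by rewrite E1 => a aS; apply: cx; rewrite mem_cat aS.
suff : [set x | forall t, t \in l -> G t x] x by apply.
by rewrite E2 => a aS; apply: cx; rewrite mem_cat aS orbT.
Qed.

End Cones.

(** * Indicator vectors *)

Section Indicators.
Context {R : realType} {n : nat}.
Notation one := (@ind_vec R n [set: 'I_n]%SET).
Implicit Types (T : {set 'I_n}) (x d : 'rV[R]_n).

Lemma dot_ind T x : dot (ind_vec T) x = \sum_(i in T) x 0 i.
Proof.
rewrite /dot [RHS]big_mkcond; apply: eq_bigr => i _; rewrite mxE.
by case: (i \in T); rewrite ?mul1r ?mul0r.
Qed.

Lemma ind_delta T i : dot (ind_vec T : 'rV[R]_n) (delta_mx 0 i) = (i \in T)%:R.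
Proof. by rewrite dot_delta mxE. Qed.

Lemma neqT_notin T : T != [set: 'I_n]%SET -> exists i, i \notin T.
Proof.
move=> /eqP nT; apply: contrapT => no; apply: nT; apply/setP => i.
by rewrite [RHS]inE; apply/negPn/negP => iT; apply: no; exists i.
Qed.

(** The recession cone is trivial as soon as all coordinates are bounded below and
    their sum is bounded above. *)
Lemma singletons_bounded (s : seq ('rV[R]_n * R)) :
  (exists k, (- one, k) \in s) ->
  (forall i, exists k, (ind_vec [set i]%SET, k) \in s) -> bounded_sys s.
Proof.
move=> [k ks] is_ d hd.
have d0 i : 0 <= d 0 i.
  by have [k' /hd] := is_ i; rewrite /= dot_ind big_set1.
have := hd _ ks; rewrite /= dotNl dot_ind oppr_ge0 => s0.
have /eqP : \sum_(i in [set: 'I_n]%SET) d 0 i = 0.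
  by apply/eqP; rewrite eq_le s0 sumr_ge0.
rewrite psumr_eq0 // => /allP z; apply/rowP => i; rewrite mxE.
by have := z i (mem_index_enum _); rewrite inE => /eqP.
Qed.

End Indicators.

(** * Deformation cones *)

Section Deformation.
Context {R : realType} {n : nat}.
Hypothesis n2 : (2 <= n)%N.
Notation rV := 'rV[R]_n.
Notation U := (seq_sub (@braid_vecs R n)).
Notation one := (@ind_vec R n [set: 'I_n]%SET).
Implicit Types (u : U) (w x y z d : rV) (P Q : set rV) (f g : {ffun U -> R}).

Lemma one_mem : one \in @braid_vecs R n. Proof. exact: mem_head. Qed.

(** The all-ones vector, as an element of [U]. *)
Definition oneU : U := SeqSub one_mem.

Lemma flag_mem (F : {set {set 'I_n}}) : is_flag F -> flag_vec F \in @braid_vecs R n.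
Proof. by move=> fF; rewrite inE map_f ?orbT // mem_enum. Qed.

Lemma set1_neq (i : 'I_n) : [set i]%SET != [set: 'I_n]%SET.
Proof.
by apply/eqP => E; move: n2; rewrite -(card_ord n) -cardsT -E cards1.
Qed.

Lemma flag1 (T : {set 'I_n}) : T != finset.set0 -> T != [set: 'I_n]%SET ->
  is_flag [set T]%SET.
Proof.
move=> T0 T1; apply/and3P; split.
- by apply/set0Pn; exists T; rewrite inE.
- by apply/forall_inP => A /set1P ->; rewrite T0.
- by apply/forall_inP => A /set1P ->; apply/forall_inP => B /set1P ->; rewrite subxx.
Qed.

Lemma ind_mem (T : {set 'I_n}) : T != finset.set0 -> ind_vec T \in @braid_vecs R n.
Proof.
move=> T0; have [->|T1] := eqVneq T [set: 'I_n]%SET; first exact: one_mem.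
have := flag_mem (flag1 T0 T1); rewrite /flag_vec big_set1; exact.
Qed.

(** The system [u . x >= f u] for all [u] in [U], completed by the opposite
    inequality for [one]: the sum of the coordinates of a solution is [f oneU]. *)
Definition Usys f : seq (rV * R) :=
  (- one, - f oneU) :: [seq (val u, f u) | u <- enum {: U}].

(** The polytope of the solutions of [Usys f]. *)
Definition Upoly f : set rV := hpoly (Usys f).

Lemma UpolyP f x :
  Upoly f x <-> (forall u, f u <= dot (val u) x) /\ dot one x = f oneU.
Proof.
split=> [Px|[fx x1] c].
  have fx u : f u <= dot (val u) x.
    apply: (Px (val u, f u)); rewrite inE; apply/orP; right.
    by apply/mapP; exists u => //; rewrite mem_enum.
  split=> //; apply/eqP; rewrite eq_le (fx oneU) andbT.
  by have := Px _ (mem_head _ _); rewrite /= dotNl lerN2.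
rewrite inE => /orP[/eqP->|/mapP[u _ ->]] //=.
by rewrite dotNl x1.
Qed.

Lemma Usys_bounded f : bounded_sys (Usys f).
Proof.
apply: singletons_bounded => [|i]; first by exists (- f oneU); exact: mem_head.
have i0 : [set i]%SET != finset.set0 by apply/set0Pn; exists i; rewrite inE.
exists (f (SeqSub (ind_mem i0))); rewrite inE; apply/orP; right.
by apply/mapP; exists (SeqSub (ind_mem i0)) => //; rewrite mem_enum.
Qed.

(** Nonempty polytopes all of whose facet directions are in [U], modulo [one]. *)
Definition Uform P := (exists f, P = Upoly f) /\ P !=set0.

Lemma Uform_argmin P w : Uform P -> argmin P w !=set0.
Proof. by move=> [[f ->] ne]; apply: argmin_ex => //; exact: Usys_bounded. Qed.

(** The right-hand sides may be taken to be the minima of the functionals. *)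
Lemma Uform_support P : Uform P -> P = Upoly (support_vec P).
Proof.
move=> UP; have att w := Uform_argmin w UP; case: UP => [[f Ef] ne].
have one_h : h P one = f oneU.
  have [x mx] := att one; rewrite (hE mx).
  by have := mx.1; rewrite Ef => /UpolyP[].
apply/seteqP; split=> x.
  move=> Px; apply/UpolyP; split=> [u|]; first by rewrite ffunE h_le.
  by rewrite ffunE one_h; move: Px; rewrite Ef => /UpolyP[].
move=> /UpolyP[hx x1]; rewrite Ef; apply/UpolyP; split=> [u|].
  apply: le_trans (hx u); rewrite ffunE; have [y my] := att (val u).
  by rewrite (hE my); have := my.1; rewrite {1}Ef => /UpolyP[].
by rewrite x1 ffunE one_h.
Qed.

(** On a point [x] of [P]: the functional [u] attains its minimum over [P] at [x]. *)
Definition tightU P x u := dot (val u) x == h P (val u).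

Lemma tight_one P x : Uform P -> P x -> tightU P x oneU.
Proof.
by move=> /Uform_support EP; rewrite {1}EP => /UpolyP[_]; rewrite ffunE => /eqP.
Qed.

Lemma Uform_le P x u : Uform P -> P x -> h P (val u) <= dot (val u) x.
Proof. by move=> UP; apply: h_le; exact: Uform_argmin. Qed.

(** A direction that weakly increases all the tight functionals of [z] is a
    feasible direction of [P] at [z]. *)
Lemma Uform_step P z d : Uform P -> P z ->
  (forall u, tightU P z u -> 0 <= dot (val u) d) -> dot one d = 0 ->
  exists2 e : R, 0 < e & P (z + e *: d).
Proof.
move=> UP Pz hd d1; rewrite {1}(Uform_support UP).
apply: hpoly_step; first by rewrite -/(Upoly _) -Uform_support.
move=> c; rewrite inE => /orP[/eqP->|/mapP[u _ ->]].
  by rewrite /= dotNl d1 oppr0.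
by rewrite /tight /= ffunE; exact: hd.
Qed.

(** The functional [w] does not decrease along the directions that are feasible at
    one of its minimizers. *)
Lemma Uform_tangent P z w d : Uform P -> argmin P w z ->
  (forall u, tightU P z u -> 0 <= dot (val u) d) -> dot one d = 0 ->
  0 <= dot w d.
Proof.
move=> UP mz hd d1; have [e e0 /mz.2] := Uform_step UP mz.1 hd d1.
by rewrite dotDr dotZr lerDl pmulr_rge0.
Qed.

Lemma Uform_mid P x y : Uform P -> P x -> P y -> P (2^-1 *: (x + y)).
Proof.
move=> UP; rewrite (Uform_support UP) => /UpolyP[ux ox] /UpolyP[uy oy].
apply/UpolyP; split=> [u|]; rewrite dotZr dotDr.
  by have := ux u; have := uy u; lra.
by rewrite ox oy; lra.
Qed.

(** Every point of [P] is dominated by a vertex, as regards tightness. *)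
Lemma Uform_basic P x : Uform P -> P x -> exists z, [/\ P z,
  forall u, tightU P x u -> tightU P z u &
  forall d, (forall u, tightU P z u -> dot (val u) d = 0) -> d = 0].
Proof.
move=> UP Px; have EP := Uform_support UP.
have [|z [Pz bz _ tz]] :=
    @basic_below _ _ (Usys (support_vec P)) x 0 (@Usys_bounded _).
  by rewrite -/(Upoly _) -EP.
rewrite -/(Upoly _) -EP in Pz.
have mU u : (val u, support_vec P u) \in Usys (support_vec P).
  by rewrite inE; apply/orP; right; apply/mapP; exists u => //; rewrite mem_enum.
exists z; split=> // [u tu|d hd].
  by have := tz _ (mU u); rewrite /tight /= ffunE; apply.
apply: bz => c; rewrite inE => /orP[/eqP->|/mapP[u _ ->]] tc /=.
  by rewrite dotNl (hd oneU) ?oppr0 //; exact: tight_one.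
by apply: hd; move: tc; rewrite /tight /= ffunE.
Qed.

Lemma conv_in m (p : 'I_m -> rV) i : conv p (p i).
Proof.
exists (fun j => (j == i)%:R); split=> [j||]; first by rewrite ler0n.
  by rewrite (bigD1 i) //= eqxx big1 ?addr0 // => j /negbTE ->.
rewrite (bigD1 i) //= eqxx scale1r big1 ?addr0 // => j /negbTE ->.
by rewrite scale0r.
Qed.

Lemma conv_ge m (p : 'I_m -> rV) w (k : R) : (forall i, k <= dot w (p i)) ->
  forall q, conv p q -> k <= dot w q.
Proof.
move=> kp _ [l [l0 l1 ->]]; rewrite dot_sumr -[leLHS]mul1r -l1 mulr_suml.
by apply: ler_sum => i _; rewrite dotZr ler_wpM2l.
Qed.

Lemma conv_argmin Q w : polytope Q -> argmin Q w !=set0.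
Proof.
move=> [m [p ->]].
have [i _ mi] :=
  seq_argmin (fun i => dot w (p i)) (mem_index_enum (ord0 : 'I_m.+1)).
exists (p i); split; first exact: conv_in.
by apply: conv_ge => j; apply: mi; exact: mem_index_enum.
Qed.

(** [g] is a deformation of [P]: each point [x] of [P] has a counterpart [y] in
    the polytope of [g], where all of the functionals tight at [x] are tight. *)
Definition deforms P g := forall x, P x -> exists y,
  (forall u, tightU P x u -> dot (val u) y = g u) /\
  (forall u, g u <= dot (val u) y).

Lemma deformation_deforms P g : Uform P -> deformation_cone P g -> deforms P g.
Proof.
move=> UP [Q [pQ coa] <-] x Px.
(* The functional [w] is minimal on [P] exactly where all of the functionals tight
   at [x] are tight; the counterpart of [x] is a minimizer of [w] over [Q]. *)
pose w := \sum_(u | tightU P x u) val u.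
have [y my] := conv_argmin w pQ.
have fG : face Q (argmin Q w) by apply: argmin_face; exists y.
have [D DS E] := coa _ (@imageP _ _ (normal_cone Q) _ _ fG).
have : normal_cone Q (argmin Q w) w by move=> z mz; rewrite (hE mz).
rewrite E => -[K DK Kw]; have [F fF EK] := DS _ DK.
have KG : K `<=` normal_cone Q (argmin Q w) by rewrite E => v Kv; exists K.
have wx : dot w x = \sum_(u | tightU P x u) h P (val u).
  by rewrite dot_suml; apply: eq_bigr => u /eqP.
have Fu x' u : F x' -> tightU P x u -> dot (val u) x' = h P (val u).
  move=> Fx tu; have Px' := face_in fF Fx.
  have : \sum_(u | tightU P x u) (dot (val u) x' - h P (val u)) == 0.
    rewrite eq_le sumr_ge0 ?andbT => [|v _]; last by rewrite subr_ge0 Uform_le.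
    rewrite sumrB -wx -dot_suml subr_le0.
    move: Kw; rewrite -EK => /(_ _ Fx) ->.
    by apply: h_le => //; exact: Uform_argmin.
  rewrite psumr_eq0 => [/allP/(_ u (mem_index_enum _))|v _].
    by rewrite tu subr_eq0 => /eqP.
  by rewrite subr_ge0 Uform_le.
exists y; split=> u; rewrite ffunE; last by apply: h_le my.1; exact: conv_argmin.
move=> tu; have : K (val u) by rewrite -EK => x' Fx'; exact: Fu.
by move/KG/(_ _ my).
Qed.

(** The set of the functionals that are tight at [x]. *)
Definition tset P x : {set U} := [set u | tightU P x u]%SET.

(** The deformed polytope is the convex hull of the counterparts of the points of
    [P], one for each set of tight functionals. *)
Lemma deforms_deformation P g : Uform P -> deforms P g -> deformation_cone P g.
Proof.
move=> UP dg; have [x0 P0] := UP.2.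
have /boolp.choice[y yP] : forall J : {set U}, exists y, [/\
    forall u, g u <= dot (val u) y, dot one y = g oneU &
    forall x, P x -> tset P x = J -> forall u, tightU P x u -> dot (val u) y = g u].
  move=> J; have [[x Px EJ]|no] := pselect (exists2 x, P x & tset P x = J).
    have [y [ty gy]] := dg x Px; exists y; split=> //.
      by rewrite -[one]/(val oneU) ty //; exact: tight_one.
    move=> x' _ E' u tu; apply: ty.
    have : u \in tset P x' by rewrite inE.
    by rewrite E' -EJ inE.
  have [y [ty gy]] := dg x0 P0; exists y; split=> //.
    by rewrite -[one]/(val oneU) ty //; exact: tight_one.
  by move=> x Px EJ; case: no; exists x.
(* The convex hull is indexed by an enumeration of all sets of functionals; those
   that are not of the form [tset P x] yield redundant points. *)
pose m := #|{set U}|.-1.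
pose p (i : 'I_m.+1) := y (nth finset.set0 (enum {set U}) i).
have m1 : m.+1 = #|{set U}|.
  by rewrite prednK //; apply/card_gt0P; exists finset.set0.
have pJ J : conv p (y J).
  have iJ : (index J (enum {set U}) < m.+1)%N.
    by rewrite m1 cardE index_mem mem_enum.
  have := conv_in p (Ordinal iJ).
  by rewrite /p /= nth_index // mem_enum.
have qge q u : conv p q -> g u <= dot (val u) q.
  by apply: conv_ge => i; case: (yP (nth finset.set0 (enum {set U}) i)).
have qone q : conv p q -> dot one q = g oneU.
  move=> cq; apply/eqP; rewrite eq_le (qge q oneU cq) andbT -lerN2 -dotNl.
  move: q cq; apply: conv_ge => i; rewrite dotNl lerN2.
  by case: (yP (nth finset.set0 (enum {set U}) i)) => _ ->.
have yt x u : P x -> tightU P x u -> dot (val u) (y (tset P x)) = g u.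
  by move=> Px; case: (yP (tset P x)) => _ _; apply.
(* Each functional of [P] is minimized over the new polytope at the points that
   correspond to its minimizers on [P]. *)
have ymin x w : argmin P w x -> argmin (conv p) w (y (tset P x)).
  move=> mx; split=> // q cq; rewrite -subr_ge0 -dotBr.
  apply: (Uform_tangent UP mx) => [u tu|]; rewrite dotBr.
    by rewrite subr_ge0 yt ?qge //; exact: mx.1.
  by rewrite !qone ?subrr.
exists (conv p); last first.
  apply/ffunP => u; rewrite ffunE; have [x mx] := Uform_argmin (val u) UP.
  rewrite (hE (ymin _ _ mx)) yt //; first exact: mx.1.
  by rewrite /tightU (hE mx).
split; first by exists m, p.
move=> C [G fG <-].
exists [set K | normal_fan P K /\ K `<=` normal_cone (conv p) G].
  by move=> K [].
apply/seteqP; split=> [w NG|w [K [_ KG] /KG//]].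
have att := Uform_argmin w UP.
exists (normal_cone P (argmin P w)); last by move=> x mx; rewrite (hE mx).
split; first by exists (argmin P w) => //; exact: argmin_face.
(* A relative interior point [z] of the face of [P] where [w] is minimal. *)
have [||x x' u mx mx' _|z mz tz] :=
    @min_tight _ _ (argmin P w) (index_enum U) (fun u x => tightU P x u)
      (fun x x' => 2^-1 *: (x + x')).
- exact: att.
- move=> x x' [Px mx] [Px' mx']; split; first exact: Uform_mid.
  by move=> v Pv; rewrite dotZr dotDr; have := mx _ Pv; have := mx' _ Pv; lra.
- rewrite /tightU dotZr dotDr => /eqP E.
  have := Uform_le u UP mx.1; have := Uform_le u UP mx'.1 => h1 h2.
  by apply/andP; split; apply/eqP; lra.
move=> w' Nw' q Gq; have cq := face_in fG Gq.
have Nw := NG _ Gq.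
have mz' : argmin P w' z.
  by apply: argmin_h; [exact: Uform_argmin | exact: mz.1 | exact: Nw'].
have z1 : dot one (q - y (tset P z)) = 0 by rewrite dotBr !qone ?subrr.
have zd u : tightU P z u -> 0 <= dot (val u) (q - y (tset P z)).
  by move=> tu; rewrite dotBr subr_ge0 (yt _ _ mz.1 tu) qge.
have [e e0 Pe] := Uform_step UP mz.1 zd z1.
have me : argmin P w (z + e *: (q - y (tset P z))).
  split=> // v Pv; rewrite dotDr dotZr dotBr Nw (hE (ymin _ _ mz)) subrr mulr0 addr0.
  exact: mz.2.
have zd0 u : tightU P z u -> dot (val u) (q - y (tset P z)) = 0.
  move=> tu; have := tz _ u me (mem_index_enum _) tu.
  rewrite /tightU dotDr dotZr (eqP tu) -subr_eq0 addrAC subrr add0r mulf_eq0.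
  by rewrite gt_eqF //= => /eqP.
have w'd : dot w' (q - y (tset P z)) = 0.
  apply/eqP; rewrite eq_le (Uform_tangent UP mz') // andbT.
  rewrite -oppr_ge0 -dotNr (Uform_tangent UP mz') // => [u tu|].
    by rewrite dotNr zd0 // oppr0.
  by rewrite dotNr z1 oppr0.
rewrite (hE (ymin _ _ mz')); apply/eqP; rewrite -subr_eq0 -dotBr w'd.
by rewrite eqxx.
Qed.

Lemma deformation_coneE P : Uform P -> deformation_cone P = deforms P.
Proof.
move=> UP; apply/seteqP; split=> g.
  exact: deformation_deforms.
exact: deforms_deformation.
Qed.

(** The deformation cones of two polytopes meet in a common face: if the sum of
    two deformations [g] and [g'] of [P] is a deformation of [P'], then so is [g],
    because every point of the polytope of [g + g'] is, for each linear functional,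
    dominated by a sum of points of the polytopes of [g] and [g']. *)
Lemma deformation_summand P P' g g' : Uform P -> Uform P' ->
  deforms P g -> deforms P g' -> deforms P' (g + g') -> deforms P' g.
Proof.
move=> UP UP' dg dg' dgg x' Px'.
have [y0 [ty0 gy0]] := dgg x' Px'.
pose w := \sum_(u | tightU P' x' u) val u.
have [z mz] := Uform_argmin w UP.
have [y [ty gy]] := dg z mz.1; have [y' [ty' gy']] := dg' z mz.1.
have : 0 <= dot w (y0 - (y + y')).
  apply: (Uform_tangent UP mz) => [u tu|]; rewrite dotBr dotDr.
    by rewrite ty // ty' // subr_ge0; have := gy0 u; rewrite ffunE.
  have t1 := tight_one UP mz.1; have t1' := tight_one UP' Px'.
  by rewrite -[one]/(val oneU) ty // ty' // ty0 // ffunE subrr.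
rewrite dotBr dotDr subr_ge0 !dot_suml -big_split /= => le.
have : \sum_(u | tightU P' x' u) (dot (val u) y + dot (val u) y' - dot (val u) y0) == 0.
  rewrite eq_le sumrB subr_le0 le /= -sumrB sumr_ge0 // => u tu.
  by rewrite subr_ge0 ty0 // ffunE lerD.
rewrite psumr_eq0 => [/allP E|u tu]; last by rewrite subr_ge0 ty0 // ffunE lerD.
exists y; split=> // u tu.
have := E u (mem_index_enum _); rewrite tu /= ty0 // ffunE subr_eq0 => /eqP.
have := gy u; have := gy' u; lra.
Qed.

Lemma deforms_sum P g g' : deforms P g -> deforms P g' -> deforms P (g + g').
Proof.
move=> dg dg' x Px; have [y [ty gy]] := dg x Px; have [y' [ty' gy']] := dg' x Px.
exists (y + y'); split=> u; rewrite ffunE dotDr; last by rewrite lerD.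
by move=> tu; rewrite ty // ty'.
Qed.

Lemma deforms_scale P k g : 0 < k -> deforms P g -> deforms P (scalef k g).
Proof.
move=> k0 dg x Px; have [y [ty gy]] := dg x Px.
exists (k *: y); split=> u; rewrite ffunE dotZr; last by rewrite ler_pM2l.
by move=> tu; rewrite ty.
Qed.

Lemma deforms0 P : deforms P 0.
Proof. by move=> x _; exists 0; split=> u; rewrite ffunE dot0r. Qed.

(** When the functionals in [J] span the space, the point where they take the
    values prescribed by [g] depends linearly on [g]. *)
Lemma basic_poly (J : {set U}) :
  (forall d, (forall u, u \in J -> dot (val u) d = 0) -> d = 0) ->
  polyhedral_cone [set g | exists y, (forall u, u \in J -> dot (val u) y = g u) /\
    (forall u, g u <= dot (val u) y)].
Proof.
move=> bJ.
(* The columns of [A] are the functionals in [J]; those outside of [J] are replaced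
   by zero columns. *)
pose A := \matrix_(i < n, k < #|{: U}|)
  (if enum_val k \in J then (val (enum_val k)) 0 i else 0 : R).
have dA d k : (d *m A) 0 k = if enum_val k \in J then dot (val (enum_val k)) d else 0.
  rewrite mxE; case: ifP => kJ; last by rewrite big1 // => i _; rewrite mxE kJ mulr0.
  by rewrite dotC; apply: eq_bigr => i _; rewrite mxE kJ.
have rA : row_free A.
  rewrite -kermx_eq0; apply/eqP/row_matrixP => i; rewrite row0; apply: bJ => u uJ.
  have : row i (kermx A) *m A = 0 by rewrite -row_mul mulmx_ker row0.
  move/rowP/(_ (enum_rank u)); rewrite dA mxE enum_rankK uJ; exact.
pose M u := if u \in J then row (enum_rank u) (pinvmx A) else 0.
pose L g := \sum_u g u *: M u.
have LP g y : (forall u, u \in J -> dot (val u) y = g u) -> y = L g.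
  move=> ty; rewrite -[LHS]mulmx1 -(mulmxVp rA) mulmxA mulmx_sum_row.
  rewrite /L [RHS](reindex_onto enum_val enum_rank) => [|u _]; last exact: enum_rankK.
  rewrite [RHS]big_mkcond; apply: eq_bigr => k _; rewrite enum_valK eqxx dA /M /=.
  case: ifP => kJ; last by rewrite scale0r scaler0.
  by rewrite enum_valK ty.
pose a u : {ffun U -> R} := [ffun v => dot (val u) (M v) - (v == u)%:R].
have aP u g : pairing (a u) g = dot (val u) (L g) - g u.
  rewrite dot_sumr /pairing; under eq_bigr do rewrite ffunE mulrBl.
  rewrite sumrB; congr (_ - _).
    by apply: eq_bigr => v _; rewrite dotZr mulrC.
  by rewrite (bigD1 u) //= eqxx mul1r big1 ?addr0 // => v /negbTE ->; rewrite mul0r.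
exists (map a (enum {: U}) ++ [seq - a u | u <- enum J]).
apply/seteqP; split=> g.
  move=> [y [ty gy]] b; have Ey := LP _ _ ty; rewrite Ey in ty gy.
  rewrite mem_cat => /orP[/mapP[u _ ->]|/mapP[u]].
    by rewrite aP subr_ge0.
  by rewrite mem_enum => uJ ->; rewrite pairingNl aP ty // subrr oppr0.
move=> cg; have gL u : g u <= dot (val u) (L g).
  by rewrite -subr_ge0 -aP; apply: cg; rewrite mem_cat map_f // mem_enum.
exists (L g); split=> // u uJ; apply/eqP; rewrite eq_le gL andbT -subr_ge0.
rewrite -opprB -aP -pairingNl; apply: cg; rewrite mem_cat; apply/orP; right.
by apply/mapP; exists u => //; rewrite mem_enum.
Qed.

(** The tightness patterns of the points of [P]; they determine its deformation
    cone. *)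
Definition patterns P : {set {set U}} :=
  [set J : {set U} | `[< exists2 x, P x & tset P x = J >]]%SET.

(** The functions that have a counterpart for each of the patterns in [X]. *)
Definition deforms_patterns (X : {set {set U}}) : set {ffun U -> R} :=
  [set g | forall J, J \in X -> exists y,
    (forall u, u \in J -> dot (val u) y = g u) /\ (forall u, g u <= dot (val u) y)].

Lemma deforms_patternsE P : deforms P = deforms_patterns (patterns P).
Proof.
apply/seteqP; split=> g dg.
  move=> J; rewrite inE => /asboolP[x Px <-]; have [y [ty gy]] := dg x Px.
  by exists y; split=> // u; rewrite inE; exact: ty.
move=> x Px; have [|y [ty gy]] := dg (tset P x).
  by rewrite inE; apply/asboolP; exists x.
by exists y; split=> // u tu; apply: ty; rewrite inE.
Qed.

Lemma deforms_poly P : Uform P -> polyhedral_cone (deforms P).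
Proof.
move=> UP.
pose basicJ (J : {set U}) :=
  forall d, (forall u, u \in J -> dot (val u) d = 0) -> d = 0.
pose X := [seq J <- enum (patterns P) | `[< basicJ J >]].
suff -> : deforms P = [set g | forall J, J \in X -> [set g | exists y,
    (forall u, u \in J -> dot (val u) y = g u) /\
    (forall u, g u <= dot (val u) y)] g].
  apply: poly_bigcap => J; rewrite mem_filter => /andP[/asboolP bJ _].
  exact: basic_poly.
rewrite deforms_patternsE; apply/seteqP; split=> g dg J.
  by rewrite mem_filter mem_enum => /andP[_]; exact: dg.
rewrite inE => /asboolP[x Px <-].
have [z [Pz tz bz]] := Uform_basic UP Px.
have [|y [ty gy]] := dg (tset P z).
  rewrite mem_filter mem_enum; apply/andP; split.
    by apply/asboolP => d hd; apply: bz => u tu; apply: hd; rewrite inE.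
  by rewrite inE; apply/asboolP; exists z.
by exists y; split=> // u; rewrite inE => /tz tu; apply: ty; rewrite inE.
Qed.

(** The deformation cones of any polytopes with facet directions in [U] form a
    fan. *)
Theorem deformation_fan (X : set (set rV)) : X `<=` Uform ->
  is_fan (with_faces [set deformation_cone P | P in X]).
Proof.
move=> XU; apply: with_faces_fan.
- apply: (@sub_finite_set _ _ (range deforms_patterns)).
    move=> C [P /XU UP <-]; exists (patterns P) => //.
    by rewrite deformation_coneE // deforms_patternsE.
  exact/finite_image/finite_finset.
- by move=> C [P /XU UP <-]; rewrite deformation_coneE //; exact: deforms_poly.
- move=> C D [P /XU UP <-] [P' /XU UP' <-]; rewrite !deformation_coneE //.
  apply: face_criterion.
  + exact: deforms_poly.
  + by move=> g [].
  + by split; exact: deforms0.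
  + by move=> g g' [d1 d2] [d1' d2']; split; exact: deforms_sum.
  + by move=> k g k0 [d1 d2]; split; exact: deforms_scale.
  + by move=> g g' d d' [_ d'']; split=> //; exact: (deformation_summand UP UP' d d').
Qed.

End Deformation.

(** * Facets of irredundant systems *)

Section Irredundant.
Context {R : realType} {n : nat}.
Hypothesis n2 : (2 <= n)%N.
Notation rV := 'rV[R]_n.
Notation one := (@ind_vec R n [set: 'I_n]%SET).
Notation e_ T := (@ind_vec R n T).
Implicit Types (T : {set 'I_n}) (B : {set {set 'I_n}}) (c : {set 'I_n} -> R).
Implicit Types (u v w x y z d : rV) (F G : set rV).

(** The hyperplane orthogonal to [u]. *)
Definition kerv u : {vspace rV} := lker (linfun (mulmxr u^T : rV -> 'rV[R]_1)).

Lemma mem_kerv u d : (d \in kerv u) = (dot u d == 0).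
Proof.
have E : dot u d = (d *m u^T) 0 0.
  by rewrite mxE dotC; apply: eq_bigr => i _; rewrite mxE.
rewrite memv_ker lfunE /= E; apply/eqP/eqP => [->|z]; first by rewrite mxE.
by apply/rowP => i; rewrite ord1 z mxE.
Qed.

Lemma dim_kerv (V : {vspace rV}) u d : d \in V -> dot u d != 0 ->
  (\dim (V :&: kerv u)).+1 = \dim V.
Proof.
move=> dV ud; have := limg_ker_dim (linfun (mulmxr u^T : rV -> 'rV[R]_1)) V.
rewrite -/(kerv u) => <-; rewrite -addn1; congr addn.
set f := linfun _; apply/eqP; rewrite eqn_leq; apply/andP; split.
  rewrite lt0n dimv_eq0; apply: contra ud => /eqP E.
  have : f d \in (f @: V)%VS by exact: memv_img.
  by rewrite E memv0 -mem_kerv memv_ker.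
by rewrite (leq_trans (dimvS (subvf _))) // dimvf.
Qed.

(** The polytope cut out by [e_T . x >= c T], for [T] in [B], in the hyperplane
    where the sum of the coordinates is 1. *)
Definition Bpoly B c : set rV :=
  [set x | dot one x = 1 /\ forall T, T \in B -> c T <= dot (e_ T) x].

(** Each of the inequalities defines a facet: it is the only tight one at some
    point. The singletons belong to [B], so that the polytope is bounded. *)
Definition irredundant B c :=
  [/\ forall i, [set i]%SET \in B,
      forall T, T \in B -> T != finset.set0 /\ T != [set: 'I_n]%SET &
      forall T, T \in B -> exists y, [/\ dot one y = 1, dot (e_ T) y = c T &
        forall T', T' \in B -> T' != T -> c T' < dot (e_ T') y]].

(** The system of inequalities of [Bpoly B c]. *)
Definition Bsys B c : seq (rV * R) :=
  (one, 1) :: (- one, - 1) :: [seq (e_ T, c T) | T <- enum B].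

Lemma Bsys_hpoly B c : hpoly (Bsys B c) = Bpoly B c.
Proof.
apply/seteqP; split=> x.
  move=> Px; split=> [|T TB].
    have := Px _ (mem_head _ _).
    have /Px : (- one, -1) \in Bsys B c by rewrite !inE eqxx orbT.
    by rewrite /= dotNl => h1 h2; apply/eqP; rewrite eq_le h2 -lerN2 h1.
  apply: (Px (e_ T, c T)); rewrite !inE; apply/orP; right; apply/orP; right.
  by apply/mapP; exists T; rewrite ?mem_enum.
move=> [x1 cx] a; rewrite !inE => /or3P[/eqP->|/eqP->|/mapP[T]] /=.
- by rewrite x1.
- by rewrite dotNl x1.
- by rewrite mem_enum => TB ->; exact: cx.
Qed.

Section Facets.
Variables (B : {set {set 'I_n}}) (c : {set 'I_n} -> R).
Hypothesis irr : irredundant B c.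
Notation Q := (Bpoly B c).

(** The facet where the inequality of [T] is an equality. *)
Definition Bfacet T : set rV := [set x | Q x /\ dot (e_ T) x = c T].

Lemma Bsys_bounded : bounded_sys (Bsys B c).
Proof.
have [sB _ _] := irr; apply: singletons_bounded => [|i].
  by exists (-1); rewrite !inE eqxx orbT.
exists (c [set i]%SET); rewrite !inE; apply/orP; right; apply/orP; right.
by apply/mapP; exists [set i]%SET; rewrite ?mem_enum.
Qed.

Lemma Bpoly_interior : exists2 p, dot one p = 1 &
  forall T, T \in B -> c T < dot (e_ T) p.
Proof.
have [sB _ yB] := irr.
pose i0 := Ordinal (ltnW n2); pose i1 := Ordinal n2.
have [y0 [y01 y0t y0s]] := yB _ (sB i0).
have [y1 [y11 y1t y1s]] := yB _ (sB i1).
(* The midpoint of points of two different facets: no inequality is tight at both. *)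
exists (2^-1 *: (y0 + y1)); first by rewrite dotZr dotDr y01 y11; lra.
move=> T TB; rewrite dotZr dotDr.
have [E|n0] := eqVneq T [set i0]%SET.
  have : T != [set i1]%SET by rewrite E; apply/eqP => /set1_inj.
  by move/(y1s _ TB); rewrite E y0t; lra.
have := y0s _ TB n0; have [->|/(y1s _ TB)] := eqVneq T [set i1]%SET; last lra.
by rewrite y1t; lra.
Qed.

Lemma Bpoly_ne : Q !=set0.
Proof.
by have [p p1 sp] := Bpoly_interior; exists p; split=> // T /sp/ltW.
Qed.

Lemma Bpoly_argmin w : argmin Q w !=set0.
Proof.
rewrite -Bsys_hpoly; apply: argmin_ex; first exact: Bsys_bounded.
by rewrite Bsys_hpoly; exact: Bpoly_ne.
Qed.

Lemma Bpoly_face F : face Q F -> exists v, F = argmin Q v.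
Proof.
rewrite -Bsys_hpoly; apply: face_argmin; first exact: Bsys_bounded.
by rewrite Bsys_hpoly; exact: Bpoly_ne.
Qed.

Lemma Bpoly_step z d : Q z -> dot one d = 0 ->
  (forall T, T \in B -> dot (e_ T) z = c T -> 0 <= dot (e_ T) d) ->
  exists2 e : R, 0 < e & Q (z + e *: d).
Proof.
move=> Qz d1 hd; rewrite -Bsys_hpoly; apply: hpoly_step.
  by rewrite Bsys_hpoly.
move=> a; rewrite !inE => /or3P[/eqP->|/eqP->|/mapP[T]] /=.
- by rewrite d1.
- by rewrite dotNl d1 oppr0.
- by rewrite mem_enum => TB -> /eqP; exact: hd.
Qed.

Lemma Bfacet_point T : T \in B -> exists2 y, Bfacet T y &
  forall T', T' \in B -> T' != T -> c T' < dot (e_ T') y.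
Proof.
have [_ _ yB] := irr; move=> /yB[y [y1 yt ys]]; exists y => //; split=> //.
by split=> // T' T'B; have [->|/(ys _ T'B)/ltW//] := eqVneq T' T; rewrite yt.
Qed.

Lemma Bfacet_inj T T' : T \in B -> T' \in B -> Bfacet T = Bfacet T' -> T = T'.
Proof.
move=> TB T'B E; have [y yT ys] := Bfacet_point TB.
apply/eqP/negPn/negP => ne; have := ys _ T'B; rewrite eq_sym ne => /(_ isT).
by move: yT; rewrite E => -[_ ->]; rewrite ltxx.
Qed.

Lemma Bfacet_face T : T \in B -> face Q (Bfacet T).
Proof.
move=> TB; have [y yT _] := Bfacet_point TB.
have my : argmin Q (e_ T) y by split; [exact: yT.1 | rewrite yT.2 => z [_]; exact].
exists (e_ T); rewrite (hE my) yT.2.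
by [].
Qed.

Lemma mixed_delta T : T \in B -> exists d, dot one d = 0 /\ dot (e_ T) d = 1.
Proof.
have [_ nB _] := irr; move=> /nB[/set0Pn[i iT] /neqT_notin[j jT]].
exists (delta_mx 0 i - delta_mx 0 j).
by rewrite !dotBr !ind_delta !inE iT (negbTE jT) subrr subr0.
Qed.

Lemma Bpoly_dim : aff_dim Q = \dim (kerv one).
Proof.
have [p p1 sp] := Bpoly_interior.
have Qp : Q p by split=> // T /sp/ltW.
apply/eqP; rewrite eqn_leq; apply/andP; split.
  by apply: aff_dim_le => x y [x1 _] [y1 _]; rewrite mem_kerv dotBr x1 y1 subrr.
apply: (aff_dim_ge Qp) => v; rewrite mem_kerv => /eqP v1.
have [|e e0 Qe] := Bpoly_step Qp v1.
  by move=> T /sp + E; rewrite E ltxx.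
by exists e => //; rewrite gt_eqF.
Qed.

Lemma Bfacet_dim T : T \in B -> aff_dim (Bfacet T) = \dim (kerv one :&: kerv (e_ T)).
Proof.
move=> TB; have [y yT ys] := Bfacet_point TB.
apply/eqP; rewrite eqn_leq; apply/andP; split.
  apply: aff_dim_le => x x' [[x1 _] xT] [[x1' _] xT'].
  by rewrite memv_cap !mem_kerv !dotBr x1 x1' xT xT' !subrr eqxx.
apply: (aff_dim_ge yT) => v; rewrite memv_cap !mem_kerv => /andP[/eqP v1 /eqP vT].
have [|e e0 Qe] := Bpoly_step yT.1 v1.
  move=> T' T'B; have [->|/(ys _ T'B)] := eqVneq T' T; first by rewrite vT.
  by move=> + E; rewrite E ltxx.
exists e; first by rewrite gt_eqF.
by split=> //; rewrite dotDr dotZr vT mulr0 addr0 yT.2.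
Qed.

Lemma Bfacet_codim T : T \in B ->
  (\dim (kerv one :&: kerv (e_ T))).+1 = \dim (kerv one).
Proof.
move=> /mixed_delta[d [d1 dT]]; apply: (@dim_kerv _ _ d).
  by rewrite mem_kerv d1.
by rewrite dT oner_neq0.
Qed.

Lemma Bfacet_facet T : T \in B -> facet Q (Bfacet T).
Proof.
move=> TB; split; first exact: Bfacet_face.
by rewrite Bfacet_dim // Bfacet_codim // Bpoly_dim.
Qed.

(** A face is the intersection of the facets that contain it. *)
Lemma face_cap F x : face Q F -> Q x ->
  (forall T, T \in B -> F `<=` Bfacet T -> Bfacet T x) -> F x.
Proof.
move=> /Bpoly_face[v ->] Qx hx.
have [||y y' T [[y1 cy] my] [[y1' cy'] my'] TB|z mz tz] :=
    @min_tight _ _ (argmin Q v) (enum B) (fun T x => dot (e_ T) x == c T)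
      (fun x x' => 2^-1 *: (x + x')).
- exact: Bpoly_argmin.
- move=> y y' [[y1 cy] my] [[y1' cy'] my']; split.
    split; first by rewrite dotZr dotDr y1 y1'; lra.
    by move=> T TB; rewrite dotZr dotDr; have := cy _ TB; have := cy' _ TB; lra.
  by move=> w Qw; rewrite dotZr dotDr; have := my _ Qw; have := my' _ Qw; lra.
- rewrite mem_enum in TB; rewrite dotZr dotDr => /eqP E.
  have := cy _ TB; have := cy' _ TB => h1 h2.
  by apply/andP; split; apply/eqP; lra.
have tx T : T \in B -> dot (e_ T) z = c T -> dot (e_ T) x = c T.
  move=> TB zT; have [] // := hx _ TB; move=> y my; split; first exact: my.1.
  by apply/eqP/(tz y T) => //; rewrite ?mem_enum ?zT.
have d1 : dot one (z - x) = 0 by rewrite dotBr mz.1.1 Qx.1 subrr.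
have [|e e0 Qe] := Bpoly_step mz.1 d1.
  by move=> T TB zT; rewrite dotBr zT tx // subrr.
have := mz.2 _ Qe; rewrite dotDr dotZr lerDl pmulr_rge0 // dotBr subr_ge0 => xz.
by split=> // y Qy; exact: le_trans (mz.2 _ Qy).
Qed.

(** By [face_cap], [G] is contained in some [Bfacet T]; if it were smaller, then its
    dimension would be smaller too. *)
Lemma facet_Bfacet G : facet Q G -> exists2 T, T \in B & G = Bfacet T.
Proof.
move=> [fG dG].
have [T TB GT] : exists2 T, T \in B & G `<=` Bfacet T.
  apply: contrapT => no; suff E : G = Q by move: dG; rewrite E; lia.
  apply/seteqP; split=> x; first exact: face_in.
  by move=> Qx; apply: face_cap => // T TB GT; case: no; exists T.
exists T => //; apply/seteqP; split=> // x Tx; apply: contrapT => nx.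
have [v Ev] := Bpoly_face fG.
have [z mz] := Bpoly_argmin v.
have zT : Bfacet T z by apply: GT; rewrite Ev.
have xv : dot v (x - z) != 0.
  rewrite dotBr subr_eq0; apply/eqP => E; apply: nx; rewrite Ev; split.
    exact: Tx.1.
  by rewrite E; exact: mz.2.
have xV : x - z \in (kerv one :&: kerv (e_ T))%VS.
  by rewrite memv_cap !mem_kerv !dotBr Tx.2 zT.2 Tx.1.1 zT.1.1 !subrr eqxx.
have := dim_kerv xV xv.
have : (aff_dim G <= \dim (kerv one :&: kerv (e_ T) :&: kerv v))%N.
  apply: aff_dim_le => y y' Gy Gy'; have yT := GT _ Gy; have yT' := GT _ Gy'.
  rewrite !memv_cap !mem_kerv !dotBr yT.2 yT'.2 yT.1.1 yT'.1.1 !subrr !eqxx /=.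
  rewrite Ev in Gy Gy'; rewrite subr_eq0 eq_le Gy.2 ?Gy'.2 //.
    exact: Gy.1.
  exact: Gy'.1.
have := Bfacet_codim TB; move: dG; rewrite Bpoly_dim; lia.
Qed.

(** The normal cone of a facet is a ray, up to lineality. *)
Lemma Bfacet_normal T u : T \in B -> normal_cone Q (Bfacet T) u ->
  exists a b, 0 <= a /\ u = a *: e_ T + b *: one.
Proof.
move=> TB Nu; have [y yT ys] := Bfacet_point TB.
have my : argmin Q u y.
  by apply: argmin_h; [exact: Bpoly_argmin | exact: yT.1 | exact: Nu].
have key d : dot one d = 0 -> 0 <= dot (e_ T) d -> 0 <= dot u d.
  move=> d1 dT; have [|e e0 Qe] := Bpoly_step my.1 d1.
    move=> T' T'B; have [->//|/(ys _ T'B)] := eqVneq T' T.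
    by move=> + E; rewrite E ltxx.
  by have := my.2 _ Qe; rewrite dotDr dotZr lerDl pmulr_rge0.
have [_ nB _] := irr; have [/set0Pn[i iT] /neqT_notin[j jT]] := nB _ TB.
have cst k l : (k \in T) = (l \in T) -> u 0 k = u 0 l.
  move=> kl; apply/eqP; rewrite eq_le -subr_ge0 -[X in _ && X]subr_ge0.
  rewrite -!dot_delta -!dotBr.
  by rewrite !key // dotBr !ind_delta ?inE ?kl subrr.
exists (u 0 i - u 0 j), (u 0 j); split.
  rewrite -!dot_delta -dotBr key // dotBr !ind_delta ?inE ?subrr //.
  by rewrite iT (negbTE jT) subr0.
apply/rowP => k; rewrite !mxE inE mulr1.
have [kT|kT] := boolP (k \in T).
  by rewrite mulr1 subrK; apply: cst; rewrite kT.
by rewrite mulr0 add0r; apply: cst; rewrite (negbTE kT) (negbTE jT).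
Qed.

Lemma primitive_normal T u : T \in B -> normal_cone Q (Bfacet T) u ->
  primitive_mod (lineality Q) u -> exists b, u = e_ T + b *: one.
Proof.
move=> TB Nu [lu nLu pu]; have [a [b [a0 Eu]]] := Bfacet_normal TB Nu.
have lin k : lineality Q (k *: one).
  by exists k => x [x1 _]; rewrite dotZl x1 mulr1.
have [_ nB _] := irr; have [/set0Pn[i iT] /neqT_notin[j jT]] := nB _ TB.
have ui : u 0 i = a + b by rewrite Eu !mxE inE iT !mulr1.
have uj : u 0 j = b by rewrite Eu !mxE inE (negbTE jT) mulr0 mulr1 add0r.
have aN : a \is a Num.nat.
  rewrite natrEint a0 andbT.
  have -> : a = u 0 i - u 0 j by rewrite ui uj addrK.
  by rewrite rpredB.
have /natrP[k Ek] := aN.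
have k1 : k = 1%N.
  case: k Ek => [|[|k]] // Ek.
    by case: nLu; rewrite Eu Ek scale0r add0r.
  case: (pu k.+2 (e_ T)) => //.
    by move=> l; rewrite mxE; case: (l \in T); rewrite ?rpred0 ?rpred1.
  by rewrite Eu Ek scaler_nat addrAC subrr add0r.
by exists b; rewrite Eu Ek k1 scale1r.
Qed.

(** The direction of a truncation is, up to lineality, the sum of the indicator
    vectors of the facets that contain the face. *)
Lemma face_normalE (u : set rV -> rV) F : facet_normals Q u ->
  exists b, face_normal Q u F =
    \sum_(T in B | `[< F `<=` Bfacet T >]) e_ T + b *: one.
Proof.
move=> fu.
have /boolp.choice[b bP] : forall T, exists b : R, T \in B ->
    u (Bfacet T) = e_ T + b *: one.
  move=> T; have [TB|nT] := boolP (T \in B); last by exists 0.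
  have [Nu pu] := fu _ (Bfacet_facet TB).
  by have [b Eb] := primitive_normal TB Nu pu; exists b.
exists (\sum_(T in B | `[< F `<=` Bfacet T >]) b T).
rewrite /face_normal.
have -> : [set G | facet Q G /\ F `<=` G] =
    Bfacet @` [set T | (T \in B) && `[< F `<=` Bfacet T >]].
  apply/seteqP; split=> G.
    move=> [/facet_Bfacet[T TB ->] FT]; exists T => //=.
    by rewrite TB; apply/asboolP.
  by move=> [T /andP[TB /asboolP FT] <-]; split=> //; exact: Bfacet_facet.
rewrite fsbig_image; last first.
  by move=> T T' /set_mem/andP[TB _] /set_mem/andP[T'B _]; exact: Bfacet_inj.
have -> : [set T | (T \in B) && `[< F `<=` Bfacet T >]] =
    [set` [seq T <- enum B | `[< F `<=` Bfacet T >]]].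
  by apply/seteqP; split=> T /=; rewrite mem_filter mem_enum andbC.
rewrite -fsbig_seq; last exact/filter_uniq/enum_uniq.
rewrite big_filter big_enum_cond /=.
rewrite scaler_suml -big_split /=; apply: eq_bigr => T /andP[TB _].
exact: bP.
Qed.

End Facets.
End Irredundant.

(** * Nested sets and flags *)

Section Flags.
Context {R : realType} {n : nat}.
Implicit Types (T W : {set 'I_n}) (N : {set {set 'I_n}}).

(** The two sets are nested or disjoint. *)
Definition laminar2 T W := [|| T \subset W, W \subset T | T :&: W == finset.set0].

(** In a laminar family where no member (nor the ground set) is the union of
    smaller members, the levels of the counting function form a strict chain. *)
Lemma nested_flag N : N != finset.set0 ->
  (forall T, T \in N -> T != finset.set0 /\ T != [set: 'I_n]%SET) ->
  {in N &, forall T W, laminar2 T W} ->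
  (forall W, W \in [set: 'I_n]%SET |: N ->
    exists2 j, j \in W & forall T, T \in N -> T \proper W -> j \notin T) ->
  exists2 F, is_flag F & \sum_(T in N) ind_vec T = flag_vec F :> 'rV[R]_n.
Proof.
move=> N0 Nne lam strict.
pose at_ i := [set T in N | i \in T]%SET.
pose cnt i := #|at_ i|.
have down i k : cnt i = k.+1 -> exists j, cnt j = k.
  move=> ci; have [T0 T0i] : exists T, T \in at_ i.
    by apply/set0Pn; rewrite -card_gt0 -/(cnt i) ci.
  (* [T1] is the smallest member that contains [i], and [T2] the next one, or the
     ground set; an index [j] of [T2] outside of all smaller members lies in the
     same members as [i], except [T1]. *)
  case: (@arg_minnP _ T0 (fun T => T \in at_ i) (fun T => #|T|) T0i) => T1 T1i min1.
  have [T1N iT1] : T1 \in N /\ i \in T1 by move: T1i; rewrite inE => /andP[].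
  have PT : [set: 'I_n]%SET \in ([set: 'I_n]%SET |: at_ i) :\ T1.
    by rewrite !inE eqxx /= andbT eq_sym; case: (Nne _ T1N).
  case: (@arg_minnP _ [set: 'I_n]%SET
    (fun T => T \in ([set: 'I_n]%SET |: at_ i) :\ T1) (fun T => #|T|) PT)
    => T2 T2i min2.
  have [T21 T2N iT2] : [/\ T2 != T1, T2 \in [set: 'I_n]%SET |: N & i \in T2].
    move: T2i; rewrite !inE => /andP[-> /orP[/eqP->|/andP[-> ->]]]; split=> //.
      by rewrite eqxx.
    by rewrite orbT.
  have lam2 T j : T \in N -> j \in T -> j \in T2 -> (T \subset T2) || (T2 \subset T).
    move=> TN jT jT2; move: T2N; rewrite !inE => /orP[/eqP->|T2N].
      by rewrite finset.subsetT.
    case/or3P: (lam _ _ TN T2N) => [->//|->|/eqP E]; first by rewrite orbT.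
    have : j \in T :&: T2 by rewrite inE jT.
    by rewrite E inE.
  have [j jT2 jn] := strict _ T2N.
  exists j; apply/eqP; rewrite -eqSS -ci /cnt (cardsD1 T1 (at_ i)) T1i add1n eqSS.
  apply/eqP; congr #|pred_of_set _|; apply/setP => T; rewrite !inE.
  apply/andP/idP => [[TN jT]|/and3P[T1' TN iT]].
    have T2T : T2 \subset T.
      case/orP: (lam2 _ _ TN jT jT2) => // TT2.
      have [-> //|ne] := eqVneq T T2.
      have : T \proper T2 by rewrite finset.properEneq ne.
      by move/(jn _ TN); rewrite jT.
    rewrite TN (fintype.subsetP T2T) // !andbT; apply: contra T21 => /eqP E.
    rewrite eqEcard -E T2T /= E; apply: min1.
    have T2T1 : T2 \subset T1 by rewrite -E.
    move: T2N; rewrite !inE => /orP[/eqP E2|->]; last by rewrite iT2.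
    have := Nne _ T1N; case=> _ /negP; case.
    by rewrite finset.eqEsubset finset.subsetT -E2.
  split=> //; have TI : T \in ([set: 'I_n]%SET |: at_ i) :\ T1.
    by rewrite !inE T1' TN iT orbT.
  case/orP: (lam2 _ _ TN iT iT2) => [TT2|/fintype.subsetP/(_ _ jT2)//].
  suff -> : T = T2 by [].
  by apply/eqP; rewrite eqEcard TT2; exact: min2.
have [W WN] := set0Pn _ N0; have [/set0Pn[w wW] _] := Nne _ WN.
case: (@arg_maxnP _ w xpredT cnt isT) => i0 _ max.
pose K := cnt i0.
have ex k : (k <= K)%N -> exists i, cnt i = k.
  have [d] := ubnP (K - k); elim: d k => // d IH k hd kK.
  have [E|lt] := eqVneq k K; first by exists i0.
  have [||i Ei] := IH k.+1; [lia|lia|].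
  exact: down Ei.
pose U k := [set i | (k <= cnt i)%N]%SET.
pose F := [set U (k : 'I_K).+1 | k : 'I_K]%SET.
have Uinj : injective (fun k : 'I_K => U k.+1).
  move=> k l E; apply/val_inj => /=.
  have [i Ei] := ex _ (ltn_ord k); have [j Ej] := ex _ (ltn_ord l).
  have : i \in U l.+1 by rewrite -E inE Ei.
  have : j \in U k.+1 by rewrite E inE Ej.
  rewrite !inE Ei Ej; lia.
have K0 : (0 < K)%N.
  apply: leq_trans _ (max w isT); apply/card_gt0P; exists W.
  by rewrite inE WN.
exists F; last first.
  rewrite /flag_vec big_imset /=; last by move=> k l _ _; exact: Uinj.
  apply/rowP => i; rewrite !summxE.
  transitivity ((cnt i)%:R : R).
    rewrite /cnt -sum1_card natr_sum [RHS]big_mkcond [LHS]big_mkcond.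
    by apply: eq_bigr => T _; rewrite mxE inE; case: (T \in N); case: (i \in T).
  have ciK : (cnt i <= K)%N by exact: max.
  transitivity (\sum_(k < K) ((k < cnt i)%N)%:R : R); last first.
    by apply: eq_bigr => k _; rewrite mxE inE.
  rewrite -natr_sum; congr _%:R; rewrite -big_mkcond /=.
  by rewrite -(big_ord_widen _ (fun _ => 1%N)) // sum1_card card_ord.
apply/and3P; split.
- by apply/set0Pn; exists (U 1%N); apply/imsetP; exists (Ordinal K0).
- apply/forall_inP => T /imsetP[k _ ->]; apply/andP; split.
    by apply/set0Pn; have [i Ei] := ex _ (ltn_ord k); exists i; rewrite inE Ei.
  have [i Ei] := ex _ (leq0n K); apply/eqP => E.
  have : i \in [set: 'I_n]%SET by rewrite inE.
  by rewrite -E inE Ei.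
- apply/forall_inP => T /imsetP[k _ ->]; apply/forall_inP => T' /imsetP[l _ ->].
  have mono a b : (a <= b)%N -> U b \subset U a.
    by move=> ab; apply/fintype.subsetP => i; rewrite !inE; exact: leq_trans.
  by case/orP: (leq_total k l) => kl; [rewrite orbC|]; rewrite mono.
Qed.

End Flags.

(** * The standard simplex *)

Section Simplex.
Context {R : realType} {n : nat}.
Hypothesis n2 : (2 <= n)%N.
Notation rV := 'rV[R]_n.
Notation one := (@ind_vec R n [set: 'I_n]%SET).
Notation e_ T := (@ind_vec R n T).
Implicit Types (T : {set 'I_n}) (x y z v w : rV) (F G : set rV).

(** The sets indexing the facets of the simplex: the inequality of [{i}] says that
    the coordinate [i] is nonnegative. *)
Definition singletons : {set {set 'I_n}} := [set [set i]%SET | i : 'I_n]%SET.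

Notation Delta := (Bpoly singletons (fun _ => 0 : R)).

Lemma DeltaP x : Delta x <-> dot one x = 1 /\ forall i, 0 <= x 0 i.
Proof.
split=> -[x1 hx]; split=> //.
  move=> i; have := hx [set i]%SET; rewrite dot_ind big_set1; apply.
  exact: imset_f.
by move=> T /imsetP[i _ ->]; rewrite dot_ind big_set1.
Qed.

Lemma simplexE : std_simplex = Delta.
Proof.
apply/seteqP; split=> x.
  move=> [l [l0 l1 ->]].
  have xi i : (\sum_j l j *: delta_mx 0 j : rV) 0 i = l i.
    rewrite summxE (bigD1 i) //= !mxE !eqxx mulr1 big1 ?addr0 // => j ji.
    by rewrite !mxE eq_sym (negbTE ji) andbF mulr0.
  apply/DeltaP; split=> [|i]; last by rewrite xi.
  by rewrite dot_ind -[RHS]l1; apply: eq_big => [i|i _]; rewrite ?inE ?xi.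
move=> /DeltaP[x1 x0]; exists (fun i => x 0 i); split=> //; last first.
  by rewrite [LHS]row_sum_delta.
by rewrite -x1 dot_ind; apply: eq_bigl => i; rewrite inE.
Qed.

Lemma singletons_irr : irredundant singletons (fun _ => 0 : R).
Proof.
split; first by move=> i; exact: imset_f.
  move=> T /imsetP[i _ ->]; split; last exact: set1_neq.
  by apply/set0Pn; exists i; rewrite inE.
move=> T0 /imsetP[i _ ->].
(* The barycenter of the facet where the coordinate [i] vanishes. *)
exists (n.-1%:R^-1 *: (one - e_ [set i]%SET)).
have n1 : n.-1%:R != 0 :> R by rewrite pnatr_eq0; case: n n2 => [|[|]].
have dd T : dot (e_ T) (e_ [set: 'I_n]%SET) = #|T|%:R.
  rewrite dot_ind -sum1_card natr_sum; apply: eq_bigr => j _.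
  by rewrite mxE inE.
have ds T : dot (e_ T) (e_ [set i]%SET) = (i \in T)%:R.
  by rewrite dotC dot_ind big_set1 mxE.
split=> [||T' /imsetP[j _ ->] ji]; rewrite dotZr dotBr dd ds.
- have -> : #|[set: 'I_n]%SET|%:R = n.-1%:R + 1 :> R.
    by rewrite cardsT card_ord natr1 prednK // ltnW.
  by rewrite inE addrK mulVf.
- by rewrite cards1 inE eqxx subrr mulr0.
- rewrite cards1 inE; have -> : (i == j) = false.
    by apply: contraNF ji => /eqP ->.
  by rewrite subr0 mulr1 invr_gt0 lt_neqAle eq_sym n1 ler0n.
Qed.

(** The (indices of the) facets of the simplex that contain [F]. *)
Definition facets_of F : {set 'I_n} :=
  [set i | `[< F `<=` Bfacet singletons (fun _ => 0 : R) [set i]%SET >]]%SET.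

Lemma simplex_faceE F : face Delta F ->
  F = [set x | Delta x /\ dot (e_ (facets_of F)) x = 0].
Proof.
move=> fF; apply/seteqP; split=> x.
  move=> Fx; split; first exact: face_in Fx.
  rewrite dot_ind big1 // => i; rewrite inE => /asboolP/(_ _ Fx)[_].
  by rewrite dot_ind big_set1.
move=> [Dx /eqP]; have [_ x0] := (DeltaP x).1 Dx.
rewrite dot_ind psumr_eq0 => [/allP z|i _]; last exact: x0.
apply: (face_cap n2 singletons_irr fF Dx) => T /imsetP[i _ ->] Fi; split=> //.
rewrite dot_ind big_set1; have := z i (mem_index_enum _).
by move=> /implyP; rewrite inE => /(_ _)/eqP; apply; apply/asboolP.
Qed.

Lemma facets_ofT F : face Delta F -> facets_of F != [set: 'I_n]%SET.
Proof.
move=> fF; have [v Ev] := Bpoly_face n2 singletons_irr fF.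
have [x mx] := Bpoly_argmin n2 singletons_irr v.
have Fx : F x by rewrite Ev.
apply/eqP => E; move: (Fx); rewrite (simplex_faceE fF) E => -[[-> _] /eqP].
by rewrite oner_eq0.
Qed.

Lemma facets_of0 F : proper_face Delta F -> facets_of F != finset.set0.
Proof.
move=> [fF nF]; apply/eqP => E; apply: nF; rewrite (simplex_faceE fF) E.
apply/seteqP; split=> x; first by case.
by move=> Dx; split=> //; rewrite dot_ind big_set0.
Qed.

Lemma facets_of_sub F G : face Delta F -> face Delta G ->
  facets_of G \subset facets_of F -> F `<=` G.
Proof.
move=> fF fG /fintype.subsetP GF x Fx; rewrite (simplex_faceE fG); split.
  exact: face_in Fx.
rewrite dot_ind big1 // => i /GF; rewrite inE => /asboolP/(_ _ Fx)[_].
by rewrite dot_ind big_set1.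
Qed.

Lemma delta_Delta i : Delta (delta_mx 0 i).
Proof.
apply/DeltaP; split; first by rewrite dot_delta mxE inE.
by move=> j; rewrite mxE ler0n.
Qed.

(** Different sets of coordinates vanish on different faces: the vertices of the
    face are the unit vectors outside of [A]. *)
Lemma facets_ofP F (A : {set 'I_n}) : A != [set: 'I_n]%SET ->
  F = [set x | Delta x /\ dot (e_ A) x = 0] -> facets_of F = A.
Proof.
move=> A1 ->; apply/setP => i; rewrite inE; apply/asboolP/idP => [h|iA].
  apply: contrapT => /negP iA.
  have : Bfacet singletons (fun=> 0) [set i]%SET (delta_mx 0 i : rV).
    by apply: h; split; [exact: delta_Delta | rewrite dot_delta mxE (negbTE iA)].
  by move=> [_]; rewrite dot_delta mxE inE eqxx => /eqP; rewrite oner_eq0.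
move=> x [Dx /eqP]; have [_ x0] := (DeltaP x).1 Dx.
rewrite dot_ind psumr_eq0 => [/allP z|j _]; last exact: x0.
split=> //; rewrite dot_ind big_set1; apply/eqP.
by have := z i (mem_index_enum _); rewrite iA.
Qed.

Lemma simplex_face_normal (u : set rV -> rV) F : facet_normals Delta u ->
  exists b, face_normal Delta u F = e_ (facets_of F) + b *: one.
Proof.
move=> fu; have [b ->] := face_normalE n2 singletons_irr F fu.
exists b; congr (_ + _).
have -> : \sum_(T in singletons |
    `[< F `<=` Bfacet singletons (fun=> 0 : R) T >]) e_ T = e_ (facets_of F).
  rewrite big_mkcondr /= big_imset /=; last by move=> i j _ _ /set1_inj.
  apply/rowP => j; rewrite summxE (bigD1 j) //= big1 ?addr0 => [|i ij].
    by rewrite !mxE inE; case: ifP => _; rewrite mxE ?inE ?eqxx.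
  by case: ifP => _; rewrite mxE // inE eq_sym (negbTE ij).
by [].
Qed.

End Simplex.

(** * Truncations of the simplex *)

Section Nestohedra.
Context {R : realType} {n : nat}.
Hypothesis n2 : (2 <= n)%N.
Notation rV := 'rV[R]_n.
Notation one := (@ind_vec R n [set: 'I_n]%SET).
Notation e_ T := (@ind_vec R n T).
Notation Delta := (Bpoly (@singletons n) (fun _ => 0 : R)).
Implicit Types (T W : {set 'I_n}) (x y z v w : rV) (F G : set rV).

Lemma mix_step (a b : R) : 0 < a -> exists t, [/\ 0 < t, t < 1 & 0 < a + t * b].
Proof.
move=> a0; have c0 : 0 < a + `|b| by rewrite ltr_wpDr.
exists (2^-1 * (a / (a + `|b|))).
have q0 : 0 < a / (a + `|b|) by rewrite divr_gt0.
have q1 : a / (a + `|b|) <= 1 by rewrite ler_pdivrMr // mul1r lerDl.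
split; [lra|lra|].
have : - (a / (a + `|b|) * `|b|) <= a / (a + `|b|) * b.
  rewrite -mulrN ler_wpM2l ?(ltW q0) //; have := ler_norm (- b).
  by rewrite normrN; lra.
have : a / (a + `|b|) * `|b| <= a.
  rewrite mulrAC ler_pdivrMr // ler_wpM2l ?(ltW a0) //; lra.
rewrite -mulrA; lra.
Qed.

(** A sequence of truncations [e_(A i) . x >= eps i] of the simplex. The last
    two hypotheses are what shallowness provides. *)
Section Steps.
Variables (m : nat) (A : 'I_m -> {set 'I_n}) (eps : 'I_m -> R).

(** The polytope obtained after the first [j] truncations. *)
Definition stage (j : nat) : set rV :=
  [set x | Delta x /\ forall k : 'I_m, (k < j)%N -> eps k <= dot (e_ (A k)) x].

Hypothesis A_inj : injective A.
Hypothesis A_set0 : forall i, A i != finset.set0.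
Hypothesis A_setT : forall i, A i != [set: 'I_n]%SET.
Hypothesis eps_gt0 : forall i, 0 < eps i.
Hypothesis A_singleton : forall l : 'I_n, exists i, A i = [set l]%SET.
Hypothesis A_order : forall i j, A j \subset A i -> (i <= j)%N.
Hypothesis A_union : forall i j, A i :&: A j != finset.set0 ->
  A i :|: A j != [set: 'I_n]%SET -> exists k, A k = A i :|: A j.
Hypothesis touch : forall i : 'I_m, exists2 z, stage i z & dot (e_ (A i)) z = 0.
Hypothesis push : forall (i : 'I_m) x v, stage i x -> exists z,
  [/\ stage i z, dot v z <= dot v x,
    forall k : 'I_m, (k < i)%N -> dot (e_ (A k)) x = eps k ->
      dot (e_ (A k)) z = eps k &
    dot (e_ (A i)) z = 0 \/ eps i < dot (e_ (A i)) z].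

(** All coordinates are positive. *)
Definition positive x := forall l, 0 < x 0 l.

Lemma dot_pos T x : T != finset.set0 -> positive x -> 0 < dot (e_ T) x.
Proof.
move=> /set0Pn[i iT] px; rewrite dot_ind (bigD1 i) //= ltr_wpDr ?px //.
by rewrite sumr_ge0 // => j _; exact: ltW.
Qed.

Lemma dot_sub T W x : T \subset W -> Delta x -> dot (e_ T) x <= dot (e_ W) x.
Proof.
move=> TW /DeltaP[_ x0]; rewrite !dot_ind [leRHS](big_setID T) /=.
by rewrite (finset.setIidPr TW) lerDl sumr_ge0.
Qed.

Lemma stage_conv j x y t : stage j x -> stage j y -> 0 <= t -> t <= 1 ->
  stage j ((1 - t) *: x + t *: y).
Proof.
move=> [[x1 x0] sx] [[y1 y0] sy] t0 t1; split; last first.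
  move=> k kj; rewrite dotDr !dotZr; have := sx k kj; have := sy k kj; nra.
split=> [|T TB]; first by rewrite dotDr !dotZr x1 y1; lra.
rewrite dotDr !dotZr; have := x0 T TB; have := y0 T TB; nra.
Qed.

Lemma stage_sub i j x : (i <= j)%N -> stage j x -> stage i x.
Proof. by move=> ij [Dx sx]; split=> // k ki; apply: sx; exact: leq_trans ij. Qed.

Lemma pos_conv x y t : Delta x -> positive y -> 0 < t -> t < 1 ->
  positive ((1 - t) *: x + t *: y).
Proof.
move=> /DeltaP[_ x0] py t0 t1 l; rewrite !mxE.
have := x0 l; have := py l; nra.
Qed.

(** A positive point survives the next truncation, up to a move that keeps its
    tight constraints. *)
Lemma push_pos (i : 'I_m) x : stage i x -> positive x -> exists y,
  [/\ stage i.+1 y, positive y, eps i < dot (e_ (A i)) y &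
    forall k : 'I_m, (k < i)%N ->
      (dot (e_ (A k)) x = eps k -> dot (e_ (A k)) y = eps k) /\
      (eps k < dot (e_ (A k)) x -> eps k < dot (e_ (A k)) y)].
Proof.
move=> sx px; have [z [sz vz tz ez]] := push (- e_ (A i)) sx.
have zi : eps i < dot (e_ (A i)) z.
  case: ez => // E; move: vz; rewrite !dotNl E oppr0 oppr_ge0.
  by have := dot_pos (A_set0 i) px; lra.
have a0 : 0 < dot (e_ (A i)) z - eps i by rewrite subr_gt0.
have [t [t0 t1 ta]] := mix_step (dot (e_ (A i)) x - dot (e_ (A i)) z) a0.
have yi : eps i < dot (e_ (A i)) ((1 - t) *: z + t *: x).
  by rewrite dotDr !dotZr; lra.
have sy := stage_conv sz sx (ltW t0) (ltW t1).
exists ((1 - t) *: z + t *: x); split=> //.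
- split; first exact: sy.1.
  move=> k; rewrite ltnS leq_eqVlt => /orP[/eqP/val_inj->|]; first exact: ltW.
  exact: sy.2.
- by apply: pos_conv => //; exact: sz.1.
- move=> k ki; rewrite dotDr !dotZr; split=> [E|lt].
    by rewrite E tz //; lra.
  by have := sz.2 k ki; nra.
Qed.

(** At each stage, all of the truncations made so far define facets: some positive
    point is strictly inside, and each of the inequalities is the only tight one
    at some positive point. *)
Lemma stage_irr j : (j <= m)%N ->
  (exists p, [/\ stage j p, positive p &
    forall k : 'I_m, (k < j)%N -> eps k < dot (e_ (A k)) p]) /\
  (forall i : 'I_m, (i < j)%N -> exists y, [/\ stage j y, positive y,
    dot (e_ (A i)) y = eps i &
    forall k : 'I_m, (k < j)%N -> k != i -> eps k < dot (e_ (A k)) y]).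
Proof.
elim: j => [_|j IH jm].
  split=> //; exists (n%:R^-1 *: one).
  have n0 : 0 < n%:R :> R by rewrite ltr0n ltnW.
  have p0 : positive (n%:R^-1 *: one).
    by move=> l; rewrite !mxE inE mulr1 invr_gt0.
  split=> //; split=> //; apply/DeltaP; split=> [|l]; last exact: ltW.
  rewrite dotZr dot_ind (eq_bigr (fun=> 1)) => [|l _]; last by rewrite mxE inE.
  by rewrite sumr_const cardsT card_ord mulVf // gt_eqF.
have [[p [sp pp stp]] ys] := IH (ltnW jm).
pose i := Ordinal jm.
have [p' [sp' pp' ip' kp']] := @push_pos i p sp pp.
have stp' (k : 'I_m) : (k < j.+1)%N -> eps k < dot (e_ (A k)) p'.
  rewrite ltnS leq_eqVlt => /orP[/eqP E|kj]; last first.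
    by case: (kp' k kj) => _; apply; exact: stp.
  by have -> : k = i by apply: val_inj.
split; first by exists p'.
move=> k; rewrite ltnS leq_eqVlt => /orP[/eqP E|kj]; last first.
  have [y [sy py ky ly]] := ys k kj.
  have [y' [sy' py' iy' ky']] := @push_pos i y sy py.
  exists y'; split=> //; first by case: (ky' k kj) => + _; apply.
  move=> l; rewrite ltnS leq_eqVlt => /orP[/eqP E|lj] lk.
    by have -> : l = i by apply: val_inj.
  by case: (ky' l lj) => _; apply; exact: ly.
have -> : k = i by apply: val_inj.
have [z sz ez] := touch i.
pose t := eps i / dot (e_ (A i)) p'.
have ep : 0 < dot (e_ (A i)) p' by exact: lt_trans (eps_gt0 i) ip'.
have t0 : 0 < t by rewrite divr_gt0.
have t1 : t < 1 by rewrite ltr_pdivrMr // mul1r.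
have sy := stage_conv sz (stage_sub (leqnSn _) sp') (ltW t0) (ltW t1).
have yi : dot (e_ (A i)) ((1 - t) *: z + t *: p') = eps i.
  by rewrite dotDr !dotZr ez mulr0 add0r divfK // gt_eqF.
(* On the segment from the truncated face to the interior point [p'], the point on
   the new facet. *)
exists ((1 - t) *: z + t *: p'); split=> //.
- split; first exact: sy.1.
  move=> l; rewrite ltnS leq_eqVlt => /orP[/eqP El|lj]; last exact: sy.2.
  by have -> : l = i by [apply: val_inj]; rewrite yi.
- by apply: pos_conv => //; exact: sz.1.
- move=> l; rewrite ltnS leq_eqVlt => /orP[/eqP El|lj] li.
    by move: li; rewrite -val_eqE /= El eqxx.
  have := sz.2 l lj; have := stp' l (leqW lj).
  by rewrite dotDr !dotZr; nra.
Qed.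

(** Larger sets are truncated more deeply: [eps i] is smaller than the values
    taken outside of the face of [A i], one of which is at most [eps k]. *)
Lemma eps_mono i k : A i \proper A k -> eps i < eps k.
Proof.
move=> /andP[ik nki]; have ki : (k < i)%N.
  rewrite ltn_neqAle A_order // andbT; apply: contra nki => /eqP/val_inj ->.
  exact: subxx.
have [_ ys] := stage_irr (ltnW (ltn_ord i)).
have [y [sy py ky _]] := ys k ki.
have [z [sz vz tz ez]] := push (- e_ (A i)) sy.
have zi : eps i < dot (e_ (A i)) z.
  case: ez => // E; move: vz; rewrite !dotNl E oppr0 oppr_ge0.
  by have := dot_pos (A_set0 i) py; lra.
by apply: lt_le_trans zi _; rewrite -(tz k ki ky) dot_sub //; exact: sz.1.
Qed.

Lemma eps_lt1 i : eps i < 1.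
Proof.
have [_ ys] := stage_irr (leqnn m).
have [y [[[y1 _] _] py <- _]] := ys i (ltn_ord i).
have A0 : ~: A i != finset.set0.
  by apply: contra (A_setT i) => /eqP E; rewrite -[A i]finset.setCK E finset.setC0.
have := dot_pos A0 py; move: y1; rewrite !dot_ind (big_setID (A i)) /=.
by rewrite finset.setTI finset.setTD => <-; rewrite ltrDl.
Qed.

(** Two facets that meet correspond to nested or disjoint sets: at a stage where
    [A i] has been truncated and [A j] is about to be, the facet of [A i] misses
    the face of [A j], so that it stays away from the new facet. *)
Lemma stage_laminar i j x : stage m x ->
  dot (e_ (A i)) x = eps i -> dot (e_ (A j)) x = eps j -> laminar2 (A i) (A j).
Proof.
wlog ij : i j / (i <= j)%N.
  move=> W sx ti tj; have [/W|/ltnW/W] := leqP i j; first exact.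
  by rewrite /laminar2 finset.setIC orbCA; apply.
move=> sx ti tj; apply/negPn/negP; rewrite /laminar2 !negb_or => /and3P[nij nji nI].
have lt : (i < j)%N.
  rewrite ltn_neqAle ij andbT; apply: contra nij => /eqP/val_inj ->.
  exact: subxx.
have sxj := stage_sub (ltnW (ltn_ord j)) sx.
have [z [sz vz tz ez]] := push (e_ (A j)) sxj.
have zj : dot (e_ (A j)) z = 0 by case: ez => // h; move: vz; rewrite tj; lra.
have zi := tz i lt ti.
have le : dot (e_ (A i :|: A j)) z <= eps i.
  rewrite -zi -[leRHS]addr0 -zj !dot_ind.
  rewrite (big_setID (A i)) /= (finset.setIidPr (finset.subsetUl _ _)) lerD2l.
  rewrite finset.setDUl finset.setDv finset.set0U.
  rewrite [leRHS](big_setID (A i)) /= lerDr sumr_ge0 // => l _.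
  by have [_] := (DeltaP z).1 sz.1; apply.
have [E|ne] := eqVneq (A i :|: A j) [set: 'I_n]%SET.
  by move: le; rewrite E sz.1.1; have := eps_lt1 i; lra.
have [k Ek] := A_union nI ne.
have pik : A i \proper A k.
  by rewrite Ek properUl.
have ki : (k < i)%N.
  rewrite ltn_neqAle A_order ?(proper_sub pik) // andbT.
  by apply: contraTN pik => /eqP/val_inj ->; rewrite fintype.properxx.
have := sz.2 k (ltn_trans ki lt); rewrite Ek.
have := eps_mono pik; lra.
Qed.

(** The system of the last stage. The inequalities of the simplex have become
    redundant, since all singletons have been truncated. *)
Definition final_sets : {set {set 'I_n}} := [set A i | i : 'I_m]%SET.

(** As [A] is injective, the sum has at most one term. *)
Definition final_eps T : R := \sum_(i | A i == T) eps i.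

Lemma final_epsE i : final_eps (A i) = eps i.
Proof.
rewrite /final_eps (bigD1 i) //= big1 ?addr0 // => j /andP[/eqP/A_inj ->].
by rewrite eqxx.
Qed.

Lemma final_irr : irredundant final_sets final_eps.
Proof.
split=> [l||].
- by have [i Ei] := A_singleton l; rewrite -Ei; exact: imset_f.
- by move=> T /imsetP[i _ ->].
- move=> T0 /imsetP[i _ ->]; have [_ ys] := stage_irr (leqnn m).
  have [y [[[y1 _] _] py iy ky]] := ys i (ltn_ord i).
  exists y; split=> //; first by rewrite final_epsE.
  move=> T' /imsetP[k _ ->] ki; rewrite final_epsE; apply: ky => //.
  by apply: contra ki => /eqP ->.
Qed.

Lemma final_stage : Bpoly final_sets final_eps = stage m.
Proof.
apply/seteqP; split=> x.
  move=> [x1 hx]; have hk k : eps k <= dot (e_ (A k)) x.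
    by rewrite -final_epsE; apply: hx; exact: imset_f.
  split=> [|k _]; last exact: hk.
  apply/DeltaP; split=> // l; have [i Ei] := A_singleton l.
  have := hk i; rewrite Ei dot_ind big_set1; apply: le_trans; exact: ltW.
move=> [[x1 _] hx]; split=> // T /imsetP[k _ ->]; rewrite final_epsE.
exact: hx.
Qed.

End Steps.

End Nestohedra.

(** * Nestohedra of level one and two *)

Section TwoNestohedra.
Context {R : realType} {n : nat}.
Hypothesis n2 : (2 <= n)%N.
Notation rV := 'rV[R]_n.
Notation one := (@ind_vec R n [set: 'I_n]%SET).
Notation e_ T := (@ind_vec R n T).
Notation Delta := (Bpoly (@singletons n) (fun _ => 0 : R)).
Implicit Types (T W : {set 'I_n}) (x y z v w : rV) (P Q F G : set rV).

Section Stage.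
Variables (m : nat) (A : 'I_m -> {set 'I_n}) (eps : 'I_m -> R).

(** The system of inequalities of [stage A eps j]. *)
Definition stage_sys (j : nat) : seq (rV * R) :=
  Bsys (@singletons n) (fun _ => 0) ++
  [seq (e_ (A k), eps k) | k <- [seq k : 'I_m <- enum 'I_m | (k < j)%N]].

Lemma stage_sysE j : hpoly (stage_sys j) = stage A eps j.
Proof.
rewrite hpoly_cat Bsys_hpoly; apply/seteqP; split=> x [Dx sx]; split=> //.
  move=> k kj; apply: (sx (e_ (A k), eps k)); apply/mapP; exists k => //.
  by rewrite mem_filter kj mem_enum.
by move=> c /mapP[k]; rewrite mem_filter => /andP[kj _] ->; exact: sx.
Qed.

Lemma stage_bounded j : bounded_sys (stage_sys j).
Proof.
move=> d hd; apply: (Bsys_bounded (singletons_irr n2)) => c cs.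
by apply: hd; rewrite mem_cat cs.
Qed.

(** One step of the truncation of the simplex, at the face [F] where the coordinates
    in [A i] vanish, in the direction of [e_(A i)] up to lineality. *)
Lemma stage_push (i : 'I_m) b F :
  F = [set x | Delta x /\ dot (e_ (A i)) x = 0] ->
  shallow (stage A eps i) (F `&` stage A eps i) (e_ (A i) + b *: one) (eps i) ->
  [/\ 0 < eps i, exists2 z, stage A eps i z & dot (e_ (A i)) z = 0,
    truncation (stage A eps i) (e_ (A i) + b *: one) (eps i) = stage A eps i.+1 &
    forall x v, stage A eps i x -> exists z,
      [/\ stage A eps i z, dot v z <= dot v x,
        forall k : 'I_m, (k < i)%N -> dot (e_ (A k)) x = eps k ->
          dot (e_ (A k)) z = eps k &
        dot (e_ (A i)) z = 0 \/ eps i < dot (e_ (A i)) z]].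
Proof.
move=> EF sh; have [[fF nF] e0 _] := sh; have bs := @stage_bounded i.
set w := e_ (A i) + b *: one in sh *.
have wE x : stage A eps i x -> dot w x = dot (e_ (A i)) x + b.
  by move=> [[x1 _] _]; rewrite /w dotDl dotZl x1 mulr1.
have eA x : stage A eps i x -> 0 <= dot (e_ (A i)) x.
  move=> [/DeltaP[_ x0] _]; rewrite dot_ind.
  by rewrite sumr_ge0.
have ne : hpoly (stage_sys i) !=set0.
  apply: contrapT => no; apply: nF; apply/seteqP; split=> x; first by case.
  by rewrite -stage_sysE => sx; case: no; exists x.
have [z Fz] : (F `&` stage A eps i) !=set0.
  have [v Ev] : exists v, F `&` stage A eps i = argmin (hpoly (stage_sys i)) v.
    by apply: face_argmin => //; rewrite stage_sysE.
  by rewrite Ev; exact: argmin_ex.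
have sz : stage A eps i z by case: Fz.
have ez : dot (e_ (A i)) z = 0 by case: Fz; rewrite EF => -[].
have mz : argmin (stage A eps i) w z.
  by split=> // y sy; rewrite !wE // ez lerD2r eA.
have EFm : F `&` stage A eps i = argmin (stage A eps i) w.
  apply/seteqP; split=> x.
    rewrite EF => -[[_ ex] sx]; split=> // y sy.
    by rewrite !wE // ex lerD2r eA.
  move=> [sx mx]; split=> //; rewrite EF; split; first by case: sx.
  apply/eqP; rewrite eq_le eA // andbT.
  by have := mx _ sz; rewrite !wE // ez lerD2r.
have hw : h (stage A eps i) w = b by rewrite (hE mz) wE // ez add0r.
split=> //; first by exists z.
- apply/seteqP; split=> x.
    move=> [sx]; rewrite hw wE // addrC lerD2r => ex; split; first by case: sx.
    move=> k; rewrite ltnS leq_eqVlt => /orP[/eqP/val_inj ->//|].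
    by case: sx => _; apply.
  move=> [Dx sx]; have sx' : stage A eps i x.
    by split=> // k ki; apply: sx; exact: leqW.
  by split=> //; rewrite hw wE // addrC lerD2r; exact: sx.
- move=> x v; rewrite -stage_sysE => sx.
  have [y [sy by_ vy ty]] := basic_below v bs sx; exists y; split=> //.
    move=> k ki /eqP ek; apply/eqP/(ty (e_ (A k), eps k)) => //.
    rewrite mem_cat; apply/orP; right; apply/mapP; exists k => //.
    by rewrite mem_filter ki mem_enum.
  have [my|ny] := pselect (argmin (hpoly (stage_sys i)) w y).
    left; move: my; rewrite stage_sysE -EFm EF => -[[] //].
  right; have := shallow_vertex bs _ (basic_vertex sy by_) ny.
  rewrite stage_sysE in sy *; move=> /(_ (eps i)); rewrite -EFm hw wE //.
  by move=> /(_ sh); lra.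
Qed.

End Stage.

(** A 1-nestohedron is given by an irredundant system in which the sets of facets
    with a common point are laminar. *)
Lemma nestohedron1 P : nestohedron R n 1 P -> exists B c,
  [/\ irredundant B c, P = Bpoly B c & forall x T W, Bpoly B c x ->
    T \in B -> W \in B -> dot (e_ T) x = c T -> dot (e_ W) x = c W ->
    laminar2 T W].
Proof.
move=> [Q [BS [-> [_ pBS fBS capBS] [u [m [F [eps [S [fu [Finj FB Ford] S0 HS ->]]]]]]]]].
rewrite simplexE // in pBS fBS capBS fu S0 HS.
pose A i := facets_of (F i).
have BF i : BS (F i) by rewrite -FB; exists i.
have pF i : proper_face Delta (F i) by exact: pBS.
have FE i : F i = [set x | Delta x /\ dot (e_ (A i)) x = 0].
  exact: (simplex_faceE n2 (pF i).1).
have A1 i : A i != [set: 'I_n]%SET := facets_ofT n2 (pF i).1.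
have A0 i : A i != finset.set0 := facets_of0 n2 (pF i).
have nE i := simplex_face_normal n2 (F i) fu.
have SE (j : nat) : (j <= m)%N -> S j = stage A eps j.
  elim: j => [_|j IH jm].
    by rewrite S0; apply/seteqP; split=> x; [split|case].
  have [sh ES] := HS (Ordinal jm).
  have [b Eb] := nE (Ordinal jm).
  rewrite /= in sh ES; rewrite (IH (ltnW jm)) Eb in sh ES.
  by have [_ _ Et _] := stage_push (FE (Ordinal jm)) sh; rewrite ES Et.
have HP (i : 'I_m) : exists b, shallow (stage A eps i) (F i `&` stage A eps i)
    (e_ (A i) + b *: one) (eps i).
  have [b Eb] := nE i; exists b; rewrite -Eb -SE; last exact: ltnW.
  by have [] := HS i.
have A_inj : injective A.
  by move=> i j E; apply: Finj; rewrite (FE i) (FE j) E.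
have A_ord i j : A j \subset A i -> (i <= j)%N.
  by move=> ji; apply: Ford; exact: (facets_of_sub n2 (pF i).1 (pF j).1).
have A_sg (l : 'I_n) : exists i, A i = [set l]%SET.
  have lS : [set l]%SET \in @singletons n by exact: imset_f.
  have : BS (Bfacet (@singletons n) (fun=> 0) [set l]%SET).
    by apply: fBS; exact: (Bfacet_facet n2 (singletons_irr n2)).
  rewrite -FB => -[i _ Ei]; exists i; rewrite /A Ei.
  apply: facets_ofP => //; exact: set1_neq.
have A_un i j : A i :&: A j != finset.set0 -> A i :|: A j != [set: 'I_n]%SET ->
    exists k, A k = A i :|: A j.
  move=> /set0Pn[l]; rewrite inE => /andP[li lj] ne.
  have EU : F i `&` F j = [set x | Delta x /\ dot (e_ (A i :|: A j)) x = 0].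
    have z0 T x : Delta x -> dot (e_ T) x = 0 <-> forall i, i \in T -> x 0 i = 0.
      move=> /DeltaP[_ x0]; rewrite dot_ind; split=> [/eqP|z]; last first.
        by rewrite big1.
      rewrite psumr_eq0 => [/allP h k kT|k _]; last exact: x0.
      by apply/eqP; have := h k (mem_index_enum _); rewrite kT.
    rewrite (FE i) (FE j); apply/seteqP; split=> x.
      move=> [[Dx /(z0 _ _ Dx) zi] [_ /(z0 _ _ Dx) zj]]; split=> //.
      by apply/z0 => // k; rewrite inE => /orP[/zi|/zj].
    move=> [Dx /(z0 _ _ Dx) zij]; split; split=> //; apply/z0 => // k kA;
      by apply: zij; rewrite inE kA ?orbT.
  have : BS (F i `&` F j).
    apply: capBS => //.
      have [k kn] := neqT_notin ne.
      rewrite EU; exists (delta_mx 0 k); split; first exact: delta_Delta.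
      by rewrite dot_delta mxE (negbTE kn).
    exists (Bfacet (@singletons n) (fun=> 0) [set l]%SET); split.
    - apply: (Bfacet_facet n2 (singletons_irr n2)); exact: imset_f.
    - by move: li; rewrite inE => /asboolP.
    - by move: lj; rewrite inE => /asboolP.
  rewrite -FB => -[k _ Ek]; exists k; rewrite /A Ek EU.
  exact: facets_ofP.
have eps0 i : 0 < eps i by have [b /(stage_push (FE i))[]] := HP i.
have tch (i : 'I_m) : exists2 z, stage A eps i z & dot (e_ (A i)) z = 0.
  by have [b /(stage_push (FE i))[]] := HP i.
have psh (i : 'I_m) x v : stage A eps i x -> exists z,
  [/\ stage A eps i z, dot v z <= dot v x,
    forall k : 'I_m, (k < i)%N -> dot (e_ (A k)) x = eps k ->
      dot (e_ (A k)) z = eps k &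
    dot (e_ (A i)) z = 0 \/ eps i < dot (e_ (A i)) z].
  by have [b /(stage_push (FE i))[_ _ _]] := HP i; apply.
exists (final_sets A), (final_eps A eps); split.
- exact: final_irr.
- by rewrite final_stage // SE.
- move=> x T W; rewrite final_stage // => sx /imsetP[i _ ->] /imsetP[j _ ->].
  rewrite !final_epsE // => ti tj.
  exact: (stage_laminar (eps := eps) n2 A0 A1 eps0 A_ord A_un tch psh sx ti tj).
Qed.

Lemma Uform_hpoly (s : seq (rV * R)) : bounded_sys s -> hpoly s !=set0 ->
  (one, 1) \in s -> (- one, - 1) \in s ->
  (forall c, c \in s -> c = (- one, - 1) \/ c.1 \in @braid_vecs R n) ->
  Uform (hpoly s).
Proof.
move=> bs ne s1 s1' sU; split=> //.
have att w : argmin (hpoly s) w !=set0 by exact: argmin_ex.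
have one1 x : hpoly s x -> dot one x = 1.
  move=> Px; have := Px _ s1; have := Px _ s1'; rewrite /= dotNl lerN2.
  by move=> h1 h2; apply/eqP; rewrite eq_le h1.
have h1 : h (hpoly s) one = 1.
  by have [x mx] := att one; rewrite (hE mx) one1 //; exact: mx.1.
exists (support_vec (hpoly s)); apply/seteqP; split=> x.
  move=> Px; apply/UpolyP; split=> [u|]; rewrite ffunE; first exact: h_le.
  by rewrite one1.
move=> /UpolyP[hx]; rewrite ffunE h1 => x1 c cs.
have [->|cU] := sU c cs; first by rewrite /= dotNl x1.
have := hx (SeqSub cU); rewrite ffunE /=; apply: le_trans.
by have [y my] := att c.1; rewrite (hE my); exact: my.1.
Qed.

(** The direction of a truncation of a 1-nestohedron is, up to lineality, the
    vector of a flag. *)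
Lemma nested_direction B c (u : set rV -> rV) F : irredundant B c ->
  (forall x T W, Bpoly B c x -> T \in B -> W \in B ->
    dot (e_ T) x = c T -> dot (e_ W) x = c W -> laminar2 T W) ->
  facet_normals (Bpoly B c) u -> proper_face (Bpoly B c) F ->
  exists2 E, is_flag E & exists b, face_normal (Bpoly B c) u F = flag_vec E + b *: one.
Proof.
move=> irr lam fu [fF nF].
pose N := [set T in B | `[< F `<=` Bfacet B c T >]]%SET.
have [v Ev] := Bpoly_face n2 irr fF.
have [x mx] := Bpoly_argmin n2 irr v.
have Fx : F x by rewrite Ev.
have Qx := mx.1.
have [sB neB yB] := irr.
have NB T : T \in N -> T \in B /\ dot (e_ T) x = c T.
  by rewrite inE => /andP[TB /asboolP/(_ _ Fx)[]].
have N0 : N != finset.set0.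
  apply/eqP => E; apply: nF; apply/seteqP; split=> y; first exact: face_in.
  move=> Qy; apply: (face_cap n2 irr fF Qy) => T TB FT.
  have : T \in N by rewrite inE TB; apply/asboolP.
  by rewrite E inE.
have Nlam : {in N &, forall T W, laminar2 T W}.
  by move=> T W /NB[TB tT] /NB[WB tW]; exact: (lam x).
have strict W : W \in [set: 'I_n]%SET |: N ->
    exists2 j, j \in W & forall T, T \in N -> T \proper W -> j \notin T.
  move=> WN.
  have [y yW ys] : exists2 y, dot (e_ W) y = dot (e_ W) x &
      forall T, T \in B -> T != W -> c T < dot (e_ T) y.
    move: WN; rewrite !inE => /orP[/eqP->|WN].
      have [p p1 sp] := Bpoly_interior n2 irr.
      by exists p => [|T TB _]; [rewrite p1 Qx.1 | exact: sp].
    have [|WB tW] := NB W; first by rewrite inE.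
    by have [y [_ yt ys]] := yB W WB; exists y => //; rewrite yt tW.
  have [i iW] : exists i, i \in W.
    move: WN; rewrite in_setU1 => /orP[/eqP->|/NB[/neB[/set0Pn//]]].
    by exists (Ordinal (ltnW n2)); rewrite inE.
  apply: contrapT => no.
  have cov j : j \in W -> exists2 T, T \in N & (T \proper W) && (j \in T).
    move=> jW; apply: contrapT => no'; apply: no; exists j => // T TN TW.
    by apply/negP => jT; apply: no'; exists T; rewrite ?TW.
  (* The maximal members of [N] inside of [W] partition [W]. *)
  pose M := [set T in N | (T \proper W) &&
    [forall T' in N, (T' \proper W) ==> (T \subset T') ==> (T' == T)]]%SET.
  have covM j : j \in W -> exists2 T, T \in M & j \in T.
    move=> jW; have [T1 T1N /andP[T1W jT1]] := cov j jW.
    have P1 : [&& T1 \in N, (T1 \proper W) & j \in T1] by rewrite T1N T1W.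
    case: (@arg_maxnP _ T1 (fun T => [&& T \in N, (T \proper W) & j \in T])
      (fun T => #|T|) P1) => T /and3P[TN TW jT] max.
    exists T => //; rewrite inE TN TW; apply/forall_inP => T' T'N.
    apply/implyP => T'W; apply/implyP => TT'; rewrite eq_sym eqEcard TT'.
    by apply: max; rewrite T'N T'W (fintype.subsetP TT').
  have tri : finset.trivIset M.
    apply/finset.trivIsetP => T T'; rewrite inE => /and3P[TN TW /forall_inP mT].
    rewrite inE => /and3P[T'N T'W /forall_inP mT'] ne.
    rewrite -finset.setI_eq0; case/or3P: (Nlam _ _ TN T'N) => // sub.
      by have := mT _ T'N; rewrite T'W sub eq_sym (negbTE ne).
    by have := mT' _ TN; rewrite TW sub (negbTE ne).
  have cM : finset.cover M = W.
    apply/setP => j; apply/finset.bigcupP/idP => [[T]|/covM[T TM jT]]; last by exists T.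
    by rewrite inE => /and3P[_ /proper_sub/fintype.subsetP TW _]; exact: TW.
  have sumM z : dot (e_ W) z = \sum_(T in M) dot (e_ T) z.
    rewrite dot_ind -cM big_trivIset //=.
    by apply: eq_bigr => T _; rewrite dot_ind.
  have [T0 T0M _] := covM i iW.
  have MN T : T \in M -> [/\ T \in B, dot (e_ T) x = c T & T != W].
    rewrite inE => /and3P[/NB[TB tT] TW _]; split=> //.
    by apply: contraTN TW => /eqP ->; rewrite fintype.properxx.
  suff : dot (e_ W) x < dot (e_ W) y by rewrite yW ltxx.
  rewrite !sumM; apply: ltr_sum => [|T /MN[TB -> TW]]; last exact: ys.
  by apply/hasP; exists T0; rewrite ?mem_index_enum.
have [E fE sumE] := @nested_flag R n N N0 (fun T TN => neB T (NB T TN).1) Nlam strict.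
exists E => //; have [b ->] := face_normalE n2 irr F fu.
exists b; rewrite -sumE; congr (_ + _).
by apply: eq_bigl => T; rewrite inE.
Qed.

(** Each truncation adds an inequality in the direction of a flag. *)
Lemma nestohedron2 P : nestohedron R n 2 P -> Uform P.
Proof.
move=> [Q [BS [/nestohedron1[B [c [irr -> lam]]] [_ pBS _ _]
  [u [m [F [eps [S [fu [_ FB _] S0 HS ->]]]]]]]]].
have pF i : proper_face (Bpoly B c) (F i) by apply: pBS; rewrite -FB; exists i.
suff key (j : nat) : (j <= m)%N -> exists s, [/\ S j = hpoly s, hpoly s !=set0,
    {subset Bsys B c <= s} &
    forall a, a \in s -> a = (- one, - 1) \/ a.1 \in @braid_vecs R n].
  have [s [-> ne sub sU]] := key m (leqnn m).
  apply: Uform_hpoly => //.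
  - by move=> d hd; apply: (Bsys_bounded irr) => a /sub; exact: hd.
  - by apply: sub; rewrite inE eqxx.
  - by apply: sub; rewrite !inE eqxx orbT.
elim: j => [_|j IH jm].
  exists (Bsys B c); split=> //; first by rewrite S0 Bsys_hpoly.
    by rewrite Bsys_hpoly; exact: Bpoly_ne.
  move=> a; rewrite !inE => /or3P[/eqP->|/eqP->|/mapP[T]].
  - by right; exact: one_mem.
  - by left.
  - by rewrite mem_enum => TB -> /=; right; apply: ind_mem => //; case: irr => _ /(_ T TB)[].
have [s [ES ne sub sU]] := IH (ltnW jm).
have [sh ES'] := HS (Ordinal jm).
have [E fE [b Eb]] := nested_direction irr lam fu (pF (Ordinal jm)).
rewrite /= in sh ES'; rewrite ES Eb in sh ES'.
have bs : bounded_sys s by move=> d hd; apply: (Bsys_bounded irr) => a /sub; exact: hd.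
have ne' := shallow_nonempty bs ne sh.
set w := flag_vec E + b *: one in sh ES' ne'.
pose k := h (hpoly s) w + eps (Ordinal jm) - b.
have Et : truncation (hpoly s) w (eps (Ordinal jm)) = hpoly ((flag_vec E, k) :: s).
  have wE x : hpoly s x -> dot w x = dot (flag_vec E) x + b.
    move=> Px; rewrite /w dotDl dotZl; suff -> : dot one x = 1 by rewrite mulr1.
    have : hpoly (Bsys B c) x by move=> a /sub; exact: Px.
    by rewrite Bsys_hpoly => -[].
  apply/seteqP; split=> x.
    move=> [Px le] a; rewrite inE => /orP[/eqP->|/Px//] /=.
    by rewrite /k lerBlDr -wE.
  move=> Px; have Psx : hpoly s x by move=> a aS; apply: Px; rewrite inE aS orbT.
  split=> //; rewrite wE // -lerBlDr; exact: (Px _ (mem_head _ _)).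
exists ((flag_vec E, k) :: s); split.
- by rewrite ES' Et.
- by rewrite -Et.
- by move=> a /sub aS; rewrite inE aS orbT.
- move=> a; rewrite inE => /orP[/eqP->|/sU//] /=; right; exact: flag_mem.
Qed.

End TwoNestohedra.

Theorem proposition5p21 (R : realType) (n : nat) (hn : (2 <= n)%N) :
  is_fan (with_faces [set deformation_cone P | P in nestohedron R n 2]).
Proof. by apply: deformation_fan => // P; exact: nestohedron2. Qed.
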